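(* Let $X$ be a proper metric space with a bicombing and cocompact isometry group. Then for every positive integer $n$ the following are equivalent: (1) There exists an isometric embedding of some $n$-dimensional normed space into $X$. (2) There is a quasi-isometric embedding of $\mathbb{R}^n$ into $X$. (3) There is a bi-Lipschitz embedding of $\mathbb{R}^n$ into some asymptotic cone $X_\omega$ of $X$. (4) There is a sequence of subsets $Z_k$ of some asymptotic cone $X_\omega$ of $X$, a sequence $0<r_k\to 0$, and a norm $\|\cdot\|$ on $\mathbb{R}^n$ such that $r_k^{-1}Z_k$ converges to the unit ball $B\subset(\mathbb{R}^n,\|\cdot\|)$ in the Gromov-Hausdorff topology. (5) There exist a sequence of sets $S_k\subset X$, a sequence $0<R_k\to\infty$, and a norm $\|\cdot\|$ on $\mathbb{R}^n$ such that $R_k^{-1}S_k$ converges to the unit ball $B\subset(\mathbb{R}^n,\|\cdot\|)$ in the Gromov-Hausdorff topology.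
   Context: A bicombing on a metric space $(X,d)$ is a map $\sigma\colon X\times X\times[0,1]\to X$, written $\sigma_{xy}(t):=\sigma(x,y,t)$, such that for all $x,y\in X$ one has $\sigma_{xy}(0)=x$, $\sigma_{xy}(1)=y$ and $d(\sigma_{xy}(t),\sigma_{xy}(t'))=|t-t'|\,d(x,y)$ for all $t,t'\in[0,1]$, and such that the conical property holds: $d(\sigma_{xy}(t),\sigma_{x'y'}(t))\le(1-t)\,d(x,x')+t\,d(y,y')$ for all $t\in[0,1]$ and all $x,y,x',y'\in X$. No equivariance of $\sigma$ under isometries is assumed. A metric space is proper if all closed balls are compact. $X$ has cocompact isometry group if there is a compact set $K\subset X$ whose translates under the isometry group of $X$ cover $X$. For a subset $S$ of a metric space and $r>0$, $r^{-1}S$ denotes $S$ with its metric multiplied by $r^{-1}$. ''Isometric embedding'' means distance-preserving map. A map $f\colon\mathbb{R}^n\to X$ is a quasi-isometric embedding if there are constants $\Lambda\ge1$, $C\ge0$ with $\Lambda^{-1}|x-y|-C\le d(f(x),f(y))\le\Lambda|x-y|+C$ for all $x,y$. An asymptotic cone $X_\omega$ of $X$ is an ultralimit, with respect to some non-principal ultrafilter $\omega$ on $\mathbb{N}$, of the pointed metric spaces $(X,\lambda_k^{-1}d,p_k)$ for some sequence of basepoints $p_k\in X$ and some sequence of scale factors $\lambda_k>0$ with $\lim_\omega\lambda_k=\infty$: its points are classes of sequences $(x_k)$ in $X$ with $\lambda_k^{-1}d(x_k,p_k)$ bounded, with distance $d_\omega((x_k),(y_k))=\lim_\omega\lambda_k^{-1}d(x_k,y_k)$,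 where sequences at distance $0$ are identified. ''Some asymptotic cone'' means for some choice of $\omega$, $(p_k)$, $(\lambda_k)$. *)

(* Defs.v *)
From HB Require Import structures.
From mathcomp Require Import all_boot all_order all_algebra generic_quotient.
From mathcomp Require Import all_classical all_reals all_analysis.

Set Implicit Arguments.
Unset Strict Implicit.
Unset Printing Implicit Defensive.

Import Order.TTheory GRing.Theory Num.Def Num.Theory.
Import numFieldNormedType.Exports.

Local Open Scope classical_set_scope.
Local Open Scope ring_scope.
Local Open Scope quotient_scope.

Section MetricSpaces.
Context {R : realType}.

(* sigma is a total function of the parameter t : R, but only its values on
   0 <= t <= 1 are constrained. *)
Record bicombing (X : metricType R) (sigma : X -> X -> R -> X) : Prop := {
  bicombing0 : forall x y, sigma x y 0 = x ;
  bicombing1 : forall x y, sigma x y 1 = y ;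
  bicombing_geodesic : forall x y t t', 0 <= t <= 1 -> 0 <= t' <= 1 ->
    mdist (sigma x y t) (sigma x y t') = `|t - t'| * mdist x y ;
  bicombing_conical : forall x y x' y' t, 0 <= t <= 1 ->
    mdist (sigma x y t) (sigma x' y' t)
      <= (1 - t) * mdist x x' + t * mdist y y' }.

Definition proper_space (X : metricType R) : Prop :=
  forall (x : X) (r : R), compact [set y | mdist x y <= r].

Definition isometry (X : metricType R) (g : X -> X) : Prop :=
  bijective g /\ forall x y, mdist (g x) (g y) = mdist x y.

Definition cocompact_isometry_group (X : metricType R) : Prop :=
  exists K : set X, compact K /\
    \bigcup_(g in [set g | isometry g]) (g @` K) = setT.

(* The norm of the library on 'rV[R]_n is the sup norm, hence this one. *)
Definition euclidean_norm n (x : 'rV[R]_n) : R :=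
  Num.sqrt (\sum_(i < n) x ord0 i ^+ 2).

Record is_norm (V : lmodType R) (N : V -> R) : Prop := {
  is_norm_triangle : forall x y, N (x + y) <= N x + N y ;
  is_norm_homogeneous : forall a x, N (a *: x) = `|a| * N x ;
  is_norm_definite : forall x, N x = 0 -> x = 0 }.

Definition isometric_embedding (V : normedModType R) (X : metricType R)
    (f : V -> X) : Prop :=
  forall x y, mdist (f x) (f y) = `|x - y|.

Definition quasi_isometric_embedding n (X : metricType R)
    (f : 'rV[R]_n -> X) : Prop :=
  exists L C : R, [/\ 1 <= L, 0 <= C & forall x y,
    L^-1 * euclidean_norm (x - y) - C <= mdist (f x) (f y)
      <= L * euclidean_norm (x - y) + C].

Definition bilipschitz_embedding n (X : metricType R)
    (f : 'rV[R]_n -> X) : Prop :=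
  exists L : R, 1 <= L /\ forall x y,
    L^-1 * euclidean_norm (x - y) <= mdist (f x) (f y)
      <= L * euclidean_norm (x - y).

Definition hausdorff_dist (Z : metricType R) (A B : set Z) : \bar R :=
  ereal_inf [set e%:E | e in [set e : R |
    [/\ 0 < e, A `<=` \bigcup_(b in B) ball b e
             & B `<=` \bigcup_(a in A) ball a e]]].

(* A metric space is passed here as a subset A of a type S together with a
   function dA : S -> S -> R which is a metric on A; this covers rescaled
   subsets of a metric space and the balls of a norm on R^n alike. *)
Definition gromov_hausdorff_dist (S T : Type)
    (dA : S -> S -> R) (A : set S) (dB : T -> T -> R) (B : set T) : \bar R :=
  ereal_inf [set h | exists (Z : metricType R) (f : S -> Z) (g : T -> Z),
    [/\ forall x y, A x -> A y -> mdist (f x) (f y) = dA x y,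
        forall x y, B x -> B y -> mdist (g x) (g y) = dB x y
      & h = hausdorff_dist (f @` A) (g @` B)]].

Definition rescaled_cvg_unit_ball n (X : metricType R)
    (r : nat -> R) (S : nat -> set X) (N : 'rV[R]_n -> R) : Prop :=
  gromov_hausdorff_dist (fun x y => (r k)^-1 * mdist x y) (S k)
    (fun x y => N (x - y)) [set x | N x <= 1] @[k --> \oo] --> 0%E.

End MetricSpaces.

Section AsymptoticCones.
Context {R : realType}.

Record cone_data (X : metricType R) := ConeData {
  cone_filter : set_system nat ;
  cone_ultra : UltraFilter cone_filter ;
  cone_nonprincipal : forall k, cone_filter <> principal_filter k ;
  cone_base : nat -> X ;
  cone_scale : nat -> R ;
  cone_scale_gt0 : forall k, 0 < cone_scale k ;
  cone_scale_infty : cone_scale k @[k --> cone_filter] --> +oo }.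

Context (X : metricType R) (c : cone_data X).
Local Notation omega := (cone_filter c).
Local Notation p := (cone_base c).
Local Notation lambda := (cone_scale c).

#[local] Instance cone_filter_ultra : UltraFilter omega := cone_ultra c.

Definition cone_bounded (x : nat -> X) : Prop :=
  exists M : R, forall k, (lambda k)^-1 * mdist (x k) (p k) <= M.

Definition cone_seq : Type := {x : nat -> X | `[< cone_bounded x >]}.
HB.instance Definition _ := Choice.on cone_seq.

Definition cone_seq_dist (x y : cone_seq) : R :=
  lim ((lambda k)^-1 * mdist (val x k) (val y k) @[k --> omega]).

Let ultra_bounded_cvg (f : nat -> R) (M : R) :
  (forall k, 0 <= f k <= M) -> cvg (f k @[k --> omega]).
Proof.
move=> fM; set F := f k @[k --> omega].
have FF : UltraFilter F.
  split=> [|G GG FG]; first exact: fmap_proper_filter.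
  apply/seteqP; split => // A GA.
  have [//|FnA] := in_ultra_setVsetC (f @^-1` A) (cone_ultra c).
  have GnA : G (~` A) by apply: FG.
  by have [z []] := @filter_ex _ G _ _ (filterI GA GnA).
have := @segment_compact R 0 M; rewrite compact_ultra => /(_ F FF)[].
  by apply: (@filterE _ omega) => k /=; rewrite in_itv /=.
by move=> l [_ Fl]; apply/cvg_ex; exists l.
Qed.

Lemma cone_seq_dist_cvg (x y : cone_seq) :
  (lambda k)^-1 * mdist (val x k) (val y k) @[k --> omega] --> cone_seq_dist x y.
Proof.
case: x y => [x xP] [y yP] /=.
have /asboolP[M xM] := xP; have /asboolP[M' yM] := yP.
apply: (@ultra_bounded_cvg _ (M + M')) => k.
have l0 : 0 <= (lambda k)^-1 by rewrite invr_ge0 ltW // cone_scale_gt0.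
rewrite mulr_ge0 ?mdist_ge0 //=.
apply: le_trans (lerD (xM k) (yM k)).
by rewrite -mulrDr ler_wpM2l // (metric_sym (y k)) metric_triangle.
Qed.

Let distxx x : cone_seq_dist x x = 0.
Proof.
rewrite /cone_seq_dist (_ : (fun k => _) = fun=> 0) ?lim_cst //.
by apply/funext => k; rewrite mdistxx mulr0.
Qed.

Let dist_sym x y : cone_seq_dist x y = cone_seq_dist y x.
Proof.
rewrite /cone_seq_dist.
by under eq_fun do rewrite metric_sym.
Qed.

Let dist_ge0 x y : 0 <= cone_seq_dist x y.
Proof.
apply: limr_ge; first exact: cone_seq_dist_cvg.
apply: (@filterE _ omega) => k.
by rewrite mulr_ge0 ?mdist_ge0 // invr_ge0 ltW // cone_scale_gt0.
Qed.

Let dist_triangle y x z :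
  cone_seq_dist x z <= cone_seq_dist x y + cone_seq_dist y z.
Proof.
have cxy := @cone_seq_dist_cvg x y; have cyz := @cone_seq_dist_cvg y z.
have /(_ _) cD := cvgD cxy cyz.
rewrite -(cvg_lim (@Rhausdorff R) cD) /=; apply: ler_lim.
- exact: cone_seq_dist_cvg.
- exact: cvgP cD.
apply: (@filterE _ omega) => k /=.
by rewrite -mulrDr ler_wpM2l ?metric_triangle // invr_ge0 ltW // cone_scale_gt0.
Qed.

Definition cone_rel (x y : cone_seq) : bool := cone_seq_dist x y == 0.

Let cone_rel_refl : reflexive cone_rel.
Proof. by move=> x; rewrite /cone_rel distxx. Qed.

Let cone_rel_sym : symmetric cone_rel.
Proof. by move=> x y; rewrite /cone_rel dist_sym. Qed.

Let cone_rel_trans : transitive cone_rel.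
Proof.
move=> y x z /eqP xy /eqP yz; rewrite /cone_rel eq_le dist_ge0 andbT.
by apply: le_trans (dist_triangle y x z) _; rewrite xy yz addr0.
Qed.

Canonical cone_equiv :=
  EquivRel cone_rel cone_rel_refl cone_rel_sym cone_rel_trans.

Definition asymptotic_cone : Type := {eq_quot cone_equiv}.
HB.instance Definition _ := Choice.on asymptotic_cone.
HB.instance Definition _ := EqQuotient.on asymptotic_cone.

Definition cone_dist (x y : asymptotic_cone) : R :=
  cone_seq_dist (repr x) (repr y).

Let cone_dist_le (x x' y y' : cone_seq) :
  cone_rel x x' -> cone_rel y y' -> cone_seq_dist x y <= cone_seq_dist x' y'.
Proof.
move=> /eqP xx' /eqP yy'; apply: le_trans (dist_triangle x' _ _) _.
by rewrite xx' add0r (le_trans (dist_triangle y' _ _)) // (dist_sym y') yy' addr0.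
Qed.

Lemma cone_distE (x y : cone_seq) :
  cone_dist (\pi_asymptotic_cone x) (\pi_asymptotic_cone y) = cone_seq_dist x y.
Proof.
have rel_repr z : cone_rel (repr (\pi_asymptotic_cone z)) z.
  have : repr (\pi_asymptotic_cone z) = z %[mod asymptotic_cone] by rewrite reprK.
  by move/eqmodP.
by apply/eqP; rewrite eq_le /cone_dist !cone_dist_le // cone_rel_sym.
Qed.

Let cone_distxx x : cone_dist x x = 0. Proof. exact: distxx. Qed.

Let cone_dist_positivity x y : cone_dist x y = 0 -> x = y.
Proof.
by move=> xy; rewrite -[x]reprK -[y]reprK; apply/eqmodP; apply/eqP.
Qed.

Let cone_dist_sym x y : cone_dist x y = cone_dist y x.
Proof. exact: dist_sym. Qed.

Let cone_dist_triangle y x z : cone_dist x z <= cone_dist x y + cone_dist y z.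
Proof. exact: dist_triangle. Qed.

HB.instance Definition _ := isMetric.Build R asymptotic_cone
  cone_distxx cone_dist_positivity cone_dist_sym cone_dist_triangle.

Lemma mdist_coneE (x y : cone_seq) :
  mdist (\pi_asymptotic_cone x) (\pi_asymptotic_cone y) = cone_seq_dist x y.
Proof. exact: cone_distE. Qed.

End AsymptoticCones.

(* Main.v *)
Require Import Defs.
From HB Require Import structures.
From mathcomp Require Import all_boot all_order all_algebra.
From mathcomp Require Import all_classical all_reals all_analysis.
From mathcomp Require Import ring lra.

(* Call a function D on V x V coarsely realized if, on every finite set, it is
   approximated by l^-1 d(phi x, phi y) for maps phi into X and arbitrarily large
   scales l.  This class is stable under affine rescaling and ultralimits.  A
   bi-Lipschitz map into a cone gives such a D, bi-Lipschitz to the norm; along a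
   fixed direction v, D can be rescaled and a limit taken so that all lines
   parallel to v are traversed at the same constant speed, and this property
   survives further rescalings.  Doing this for all directions turns D into a
   norm, without any measure theory.  Conditions (4) and (5) give a coarsely
   realized norm N directly.

   Conversely, a coarsely realized N is realized at scale 1.  Almost isometric
   maps on large balls are averaged along finitely many directions v by
   barycenters of m points F(x), F(x + v), ..., F(x + (m - 1) v) which are
   invariant under cyclic shifts: then d(G(x), G(x + v)) is at most
   d(F(x), F(x + m v)) / m up to a small error, hence almost N(v).  As G is still
   coarsely isometric on balls much larger than m, these upper bounds are almost
   attained on average, hence simultaneously at some point.  Properness and
   cocompactness then give an isometric embedding of (R^n, N) in the limit. *)

Set Implicit Arguments.
Unset Strict Implicit.
Unset Printing Implicit Defensive.

Import Order.TTheory GRing.Theory Num.Theory.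
Import numFieldNormedType.Exports.

Local Open Scope classical_set_scope.
Local Open Scope ring_scope.

(** * Limits along ultrafilters *)

Section Ultralimits.

Lemma ultra_fmap (I T : Type) (U : set_system I) (f : I -> T) :
  UltraFilter U -> UltraFilter (f @ U).
Proof.
move=> UU; split=> [|G GG UG]; first exact: fmap_proper_filter.
apply/seteqP; split => // A GA.
have [//|UnA] := in_ultra_setVsetC (f @^-1` A) UU.
have GnA : G (~` A) by apply: UG.
by have [z []] := @filter_ex _ G _ _ (filterI GA GnA).
Qed.

Lemma ultra_cvg_compact (I : Type) (T : topologicalType) (U : set_system I)
    (f : I -> T) (K : set T) :
  UltraFilter U -> compact K -> (\forall i \near U, K (f i)) ->
  exists l : T, f @ U --> l.
Proof.
move=> UU; rewrite compact_ultra => /(_ (f @ U) (ultra_fmap f UU)) Kc fK.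
by have [l [_ fl]] := Kc fK; exists l.
Qed.

Lemma ultra_cvg_bounded (R : realType) (I : Type) (U : set_system I)
    (f : I -> R) (a b : R) :
  UltraFilter U -> (forall i, a <= f i <= b) -> exists l : R, f @ U --> l.
Proof.
move=> UU fab; apply: (ultra_cvg_compact UU (@segment_compact R a b)).
by apply: (@filterE _ U) => i /=; rewrite in_itv /=.
Qed.

(** The sets of pairs above a given pair form a filter base, and any ultrafilter containing them
    works. Limits along it turn statements on finite sets with error [i.2.+1%:R^-1] into exact
    statements on all of [T], even for uncountable [T]. *)
Lemma finite_subsets_ultrafilter (T : eqType) :
  exists U : set_system (seq T * nat), [/\ UltraFilter U,
    forall x, \forall i \near U, x \in i.1 &
    forall m, \forall i \near U, (m <= i.2)%N].
Proof.
pose B (j : seq T * nat) :=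
  [set i : seq T * nat | {subset j.1 <= i.1} /\ (j.2 <= i.2)%N].
pose F := filter_from setT B.
have FF : ProperFilter F.
  apply: filter_from_proper => [|j _]; last by exists j; split.
  apply: filter_from_filter => [|j k _ _]; first by exists ([::], 0%N).
  exists (j.1 ++ k.1, maxn j.2 k.2) => // i [/= sub]; rewrite geq_max => /andP[? ?].
  by split; split => // x xi; apply: sub; rewrite mem_cat xi ?orbT.
have [U [UU FU]] := ultraFilterLemma FF.
exists U; split => // [x|m]; apply: FU.
  by exists ([:: x], 0%N) => // i [/= sub _]; apply: sub; rewrite mem_head.
by exists ([::], m) => // i [].
Qed.

Lemma ultra_nat_infty (R : realType) (T : eqType) (U : set_system (seq T * nat))
    (UU : UltraFilter U) (e : R) :
  (forall m, \forall i \near U, (m <= i.2)%N) -> 0 < e ->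
  \forall i \near U, i.2.+1%:R^-1 <= e.
Proof.
move=> Um e0; have [m _ mP] := near_infty_natSinv_lt (PosNum e0).
by apply: filterS (Um m) => i mi; exact/ltW/mP.
Qed.

Lemma cvg_ler (R : realType) (I : Type) (F : set_system I) (FF : ProperFilter F)
    (f g : I -> R) (l l' : R) :
  f @ F --> l -> g @ F --> l' -> (\forall i \near F, f i <= g i) -> l <= l'.
Proof.
move=> fl gl fg; rewrite -subr_ge0; apply: (cvgr_to_ge (cvgB gl fl)).
by apply: filterS fg => i; rewrite /= subr_ge0.
Qed.

End Ultralimits.

Lemma le_sum_exists (R : realType) (k : nat) (f : nat -> R) (c : R) :
  (0 < k)%N -> \sum_(i < k) f i <= k%:R * c -> exists2 i, (i < k)%N & f i <= c.
Proof.
move=> k0 fc; apply: contrapT => nf.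
suff : k%:R * c < \sum_(i < k) f i by rewrite ltNge fc.
have -> : k%:R * c = \sum_(i < k) c by rewrite sumr_const card_ord mulr_natl.
apply: ltr_sum => [|i _]; first by apply/hasP; exists (Ordinal k0); rewrite ?mem_index_enum.
by rewrite ltNge; apply/negP => fi; apply: nf; exists i.
Qed.

(** * Coarsely realized metrics: rescalings and ultralimits *)

Section CoarseMetrics.
Context {R : realType} (V : normedModType R) (X : metricType R).
Implicit Types (D : V -> V -> R) (v w x y : V).

(** The map [phi] may depend on [s], [e] and [T], and nothing is asked of it off [s]; this makes the
    class closed under pointwise limits. *)
Definition coarsely_realized D : Prop :=
  forall (s : seq V) (e T : R), 0 < e -> exists (l : R) (phi : V -> X),
    [/\ T <= l, 0 < l & forall x y, x \in s -> y \in s ->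
      `|mdist (phi x) (phi y) - l * D x y| <= e * l].

Definition bilipschitz_metric (a b : R) D : Prop :=
  forall x y, a * `|x - y| <= D x y <= b * `|x - y|.

(** The common speed is named [D 0 v] instead of being quantified, so that the property passes to
    pointwise limits. *)
Definition exact_along D v : Prop :=
  forall x t, 0 <= t -> D x (x + t *: v) = t * D 0 v.

Section Metric.
Variables (D : V -> V -> R) (D_coarse : coarsely_realized D).

Lemma coarse_triangle y x z : D x z <= D x y + D y z.
Proof.
apply/ler_addgt0Pr => e e0.
have [|l [phi [_ l0 phiP]]] := @D_coarse [:: x; y; z] (e / 3) 0; first lra.
have := phiP x y; have := phiP y z; have := phiP x z.
rewrite !inE !eqxx !orbT => /(_ isT isT) xz /(_ isT isT) yz /(_ isT isT) xy.
have tri := metric_triangle (phi x) (phi y) (phi z).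
rewrite -(ler_pM2l l0).
move: xz yz xy; rewrite !ler_norml; lra.
Qed.

Lemma coarse_sym x y : D x y = D y x.
Proof.
wlog suff : x y / D x y <= D y x.
  by move=> le; apply/eqP; rewrite eq_le !le.
apply/ler_addgt0Pr => e e0.
have [|l [phi [_ l0 phiP]]] := @D_coarse [:: x; y] (e / 2) 0; first lra.
have := phiP x y; have := phiP y x; rewrite (metric_sym (phi y)).
rewrite !inE !eqxx !orbT => /(_ isT isT) xy /(_ isT isT) yx.
rewrite -(ler_pM2l l0).
move: xy yx; rewrite !ler_norml; lra.
Qed.

(** The term [D x x] comes from the empty path; [bilipschitz_xx] makes it vanish in the
    application. *)
Lemma coarse_path x v k :
  D x (x + k%:R *: v) <= \sum_(i < k) D (x + i%:R *: v) (x + i.+1%:R *: v) + D x x.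
Proof.
elim: k => [|k IH]; first by rewrite scale0r addr0 big_ord0 add0r.
rewrite big_ord_recr /=.
apply: le_trans (coarse_triangle (x + k%:R *: v) _ _) _.
by rewrite addrAC lerD2r.
Qed.

Lemma coarse_rescale p r : 0 < r ->
  coarsely_realized (fun x y => r^-1 * D (p + r *: x) (p + r *: y)).
Proof.
move=> r0 s e T e0; have rn0 : r != 0 by rewrite gt_eqF.
have [|l [phi [Tl l0 phiP]]] :=
  @D_coarse [seq p + r *: x | x <- s] (e * r) (T / r); first exact: mulr_gt0.
exists (l * r), (fun x => phi (p + r *: x)); split => [| |x y xs ys].
- by rewrite -ler_pdivrMr.
- exact: mulr_gt0.
- rewrite -mulrA mulVKf // (mulrC l r) mulrA.
  by apply: phiP; apply: map_f.
Qed.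

End Metric.

Lemma bilipschitz_rescale a b D p r : 0 < r -> bilipschitz_metric a b D ->
  bilipschitz_metric a b (fun x y => r^-1 * D (p + r *: x) (p + r *: y)).
Proof.
move=> r0 Dab x y; have := Dab (p + r *: x) (p + r *: y).
rewrite opprD addrACA subrr add0r -scalerBr normrZ gtr0_norm //.
rewrite ler_pdivlMl // ler_pdivrMl //.
by rewrite !(mulrCA r).
Qed.

Lemma bilipschitz_xx a b D x : bilipschitz_metric a b D -> D x x = 0.
Proof. by move/(_ x x); rewrite subrr normr0 !mulr0 => /le_anti. Qed.

Lemma exact_along_rescale D w p r : 0 < r -> exact_along D w ->
  exact_along (fun x y => r^-1 * D (p + r *: x) (p + r *: y)) w.
Proof.
move=> r0 Dw x t t0; have rn0 : r != 0 by rewrite gt_eqF.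
rewrite scaler0 addr0 scalerDr scalerA addrA (Dw _ _ (mulr_ge0 (ltW r0) t0)).
by rewrite (Dw p r (ltW r0)); field.
Qed.

Section Limits.
Variables (I : Type) (U : set_system I) (UU : UltraFilter U).
Variables (D_ : I -> V -> V -> R) (D : V -> V -> R).
Hypothesis D_cvg : forall x y, D_ i x y @[i --> U] --> D x y.

(** Only finitely many pairs are tested, so a single [D_ i] is close to [D] on all of them, and a
    realization of this [D_ i] serves for [D]. *)
Lemma ultra_coarse : (forall i, coarsely_realized (D_ i)) -> coarsely_realized D.
Proof.
move=> D_coarse s e T e0; have e20 : 0 < e / 2 by lra.
have [i Di] : exists i, forall x y, x \in s -> y \in s -> `|D x y - D_ i x y| <= e / 2.
  suff /filter_ex[i Di] : \forall i \near U, forall u, u \in allpairs pair s s ->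
      `|D u.1 u.2 - D_ i u.1 u.2| <= e / 2.
    by exists i => x y xs ys; apply: (Di (x, y)); apply: allpairs_f.
  elim: (allpairs _ _ _) => [|u l IH]; first exact: (@filterE _ U).
  have /cvgrPdist_le/(_ _ e20) := @D_cvg u.1 u.2.
  apply: filterS2 IH => i IH ui z; rewrite inE => /predU1P[-> //|]; exact: IH.
have [l [phi [Tl l0 phiP]]] := D_coarse i s _ T e20.
exists l, phi; split => // x y xs ys.
have := phiP x y xs ys; have := Di x y xs ys.
rewrite -(ler_pM2l l0) -{1}(gtr0_norm l0) -normrM !ler_norml; lra.
Qed.

Lemma ultra_bilipschitz a b :
  (forall i, bilipschitz_metric a b (D_ i)) -> bilipschitz_metric a b D.
Proof.
move=> Dab x y; apply/andP; split.
  apply: (cvgr_to_ge (@D_cvg x y)).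
  by apply: (@filterE _ U) => i; case/andP: (Dab i x y).
apply: (cvgr_to_le (@D_cvg x y)).
by apply: (@filterE _ U) => i; case/andP: (Dab i x y).
Qed.

Lemma ultra_exact_along v :
  (\forall i \near U, exact_along (D_ i) v) -> exact_along D v.
Proof.
move=> Dv x t t0.
have lhs := @D_cvg x (x + t *: v).
have rhs : t * D_ i 0 v @[i --> U] --> t * D 0 v by apply: cvgM; [exact: cvg_cst|].
apply/eqP; rewrite eq_le; apply/andP; split.
  by apply: (cvg_ler _ lhs rhs); apply: filterS Dv => i Di; rewrite Di.
by apply: (cvg_ler _ rhs lhs); apply: filterS Dv => i Di; rewrite Di.
Qed.

End Limits.

Lemma bilipschitz_ultralimit (I : Type) (U : set_system I) (UU : UltraFilter U)
    (D_ : I -> V -> V -> R) a b :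
  (forall i, bilipschitz_metric a b (D_ i)) ->
  exists D, forall x y, D_ i x y @[i --> U] --> D x y.
Proof.
move=> Dab.
have D2 u : exists l : R, D_ i u.1 u.2 @[i --> U] --> l.
  apply: (@ultra_cvg_bounded R I U _ (a * `|u.1 - u.2|) (b * `|u.1 - u.2|) UU).
  by move=> i; exact: Dab.
have [D DP] := choice D2.
by exists (fun x y => D (x, y)) => x y; exact: (DP (x, y)).
Qed.

End CoarseMetrics.

(** * Metric differentiation: from a bi-Lipschitz coarse metric to a norm *)

Section MetricDifferentiation.
Context {R : realType} (V : normedModType R) (X : metricType R).
Variables (a b : R).
Implicit Types (D : V -> V -> R) (v w x y : V).

(** The speed [c] is the infimum of the slopes of affine upper bounds in [t] that are uniform in
    [x]. If long segments of speed almost [c] did not exist, a smaller slope would be admissible. *)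
Lemma asymptotic_speed D v : coarsely_realized X D -> bilipschitz_metric a b D ->
  0 <= a -> exists c : R, [/\ 0 <= c,
    forall e, 0 < e -> exists C, 0 <= C /\ forall x t, 0 <= t ->
      D x (x + t *: v) <= (c + e) * t + C &
    forall e T, 0 < e -> exists x t, T < t /\
      (c - e) * t <= D x (x + t *: v)].
Proof.
move=> Dc Dab a0.
have D0 x y : 0 <= D x y.
  by have /andP[+ _] := Dab x y; apply: le_trans; rewrite mulr_ge0.
have Dv x t : 0 <= t -> D x (x + t *: v) <= b * `|v| * t.
  move=> t0; have /andP[_] := Dab x (x + t *: v).
  by rewrite opprD addNKr normrN normrZ (ger0_norm t0) mulrCA mulrC.
pose A := [set c : R | exists C, 0 <= C /\
  forall x t, 0 <= t -> D x (x + t *: v) <= c * t + C].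
have A0 : A !=set0.
  by exists (b * `|v|), 0; split => // x t t0; rewrite addr0 Dv.
have lbA : lbound A 0.
  move=> c [C [C0 CP]]; rewrite leNgt; apply/negP => c0.
  (* At this [t] the bound [c * t + C] equals -1, contradicting [D0]. *)
  have t0 : 0 <= (C + 1) / - c by rewrite divr_ge0 //; lra.
  have := CP 0 _ t0; have := D0 0 (0 + ((C + 1) / - c) *: v).
  have -> : c * ((C + 1) / - c) = - (C + 1) by field; rewrite lt_eqF.
  lra.
have iA : has_inf A by split => //; exists 0.
exists (inf A); split => [|e e0|e T e0].
- by apply: lb_le_inf.
- have [c [C [C0 CP]] cA] := inf_adherent e0 iA.
  exists C; split => // x t t0; apply: le_trans (CP x t t0) _.
  by rewrite lerD2r ler_wpM2r // ltW.
- apply: contrapT => nP.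
  have : A (inf A - e).
    (* The additive constant absorbs all [t] up to the absolute value of [T]; beyond, the negated
       claim gives the slope [inf A - e]. *)
    exists (`|b * `|v| + e| * `|T|); split => [|x t t0]; first exact: mulr_ge0.
    have [tT|Tt] := leP t `|T|.
      have i0 : 0 <= inf A by apply: lb_le_inf.
      apply: le_trans (Dv x t t0) _.
      have h1 : (b * `|v| + e) * t <= `|b * `|v| + e| * `|T|.
        by apply: le_trans (ler_wpM2r t0 (ler_norm _)) _; rewrite ler_wpM2l.
      have h2 : 0 <= inf A * t by exact: mulr_ge0.
      by move: h1 h2; lra.
    have h : D x (x + t *: v) <= (inf A - e) * t.
      rewrite leNgt; apply/negP => h; apply: nP; exists x, t; split; last exact: ltW.
      exact: le_lt_trans (ler_norm T) Tt.
    by apply: le_trans h _; rewrite lerDl mulr_ge0.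
  move/(ge_inf (ex_intro _ 0 lbA)); lra.
Qed.

(* A long segment travelled at almost the asymptotic speed is cut into k pieces;
   since the translates of the segment by r *: x, x in s, lose only O(r), some
   piece is travelled at almost full speed by all of them simultaneously. *)
Lemma near_exact_rescaling D v : coarsely_realized X D ->
  bilipschitz_metric a b D -> 0 <= a -> 0 <= b ->
  exists c : R, 0 <= c /\ forall (s : seq V) (S e : R), 0 < S -> 0 < e ->
  exists p r, [/\ 0 < r,
    forall x t, 0 <= t ->
      r^-1 * D (p + r *: x) (p + r *: (x + t *: v)) <= (c + e) * t + e &
    forall x, x \in s ->
      c * S - e <= r^-1 * D (p + r *: x) (p + r *: (x + S *: v))].
Proof.
move=> Dc Dab a0 b0; have [c [c0 cU cL]] := asymptotic_speed v Dc Dab a0.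
exists c; split => // s S e S0 e0.
pose M : R := (size s)%:R + 1; have M0 : 0 < M by rewrite ltr_wpDl.
pose B := \sum_(x <- s) `|x|; have B0 : 0 <= B by apply: sumr_ge0.
(* Chosen so that the defect [3 * M * e1 * (r * S)] found below is at most [e / 3 * r]. *)
pose e1 := Num.min e (e / (9 * M * S)).
have e10 : 0 < e1 by rewrite lt_min e0 divr_gt0 // !mulr_gt0.
have e1e : e1 <= e by rewrite ge_min lexx.
have e1M : 9 * M * S * e1 <= e.
  rewrite mulrC -ler_pdivlMr ?ge_min ?lexx ?orbT // !mulr_gt0 //.
(* With this many pieces, the cost [2 * b * r * B] of moving the endpoints is at most [e / 3 * r]
   per piece. *)
pose k := (Num.Def.trunc (6 * b * B / e)).+1.
have kP : 6 * b * B <= k%:R * e by rewrite -ler_pdivrMr // ltW // truncnS_gt.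
have k0 : 0 < k%:R :> R by rewrite ltr0n.
have [C1 [C10 C1P]] := cU _ e10.
(* The threshold makes the piece scale [r = tau / (k%:R * S)] so large that [C1] is dominated by
   both [e1 * S * r] and [e * r]. *)
have [q [tau [tauT qtau]]] := cL _ (C1 * k%:R * S * ((e1 * S)^-1 + e^-1)) e10.
pose r := tau / (k%:R * S).
have kS0 : 0 < k%:R * S by rewrite mulr_gt0.
have tau0 : 0 < tau.
  by apply: le_lt_trans tauT; rewrite !mulr_ge0 // ?addr_ge0 ?invr_ge0 ?mulr_ge0 ?ltW.
have r0 : 0 < r by rewrite divr_gt0.
have tauE : tau = k%:R * (r * S) by rewrite /r; field; rewrite !gt_eqF.
have rC : C1 / (e1 * S) + C1 / e < r.
  rewrite /r ltr_pdivlMr //; apply: le_lt_trans tauT.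
  by rewrite le_eqVlt; apply/orP; left; apply/eqP; ring.
have C1S : C1 <= e1 * S * r.
  rewrite mulrC -ler_pdivrMr ?mulr_gt0 //; apply: ltW; apply: le_lt_trans rC.
  by rewrite lerDl divr_ge0 // ltW.
have C1e : C1 <= e * r.
  rewrite mulrC -ler_pdivrMr //; apply: ltW; apply: le_lt_trans rC.
  by rewrite lerDr divr_ge0 // mulr_ge0 // ltW.
pose pt (i : nat) := q + (i%:R * (r * S)) *: v.
(* One [e1] of the slack pays for the slope error, the other for [C1]; hence defects are nonnegative
   and a bound on their sum bounds each. *)
pose defect (i : nat) (x : V) :=
  (c + 2 * e1) * (r * S) - D (pt i + r *: x) (pt i + r *: (x + S *: v)).
have defect0 i x : 0 <= defect i x.
  rewrite subr_ge0 scalerDr addrA scalerA.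
  apply: le_trans (C1P _ _ _) _; first by rewrite mulr_ge0 // ltW.
  by move: C1S; lra.
have sum_defect x : \sum_(i < k) defect i x <= k%:R * (3 * e1 * (r * S)) + 2 * b * r * `|x|.
  rewrite sumrB sumr_const card_ord -mulr_natl.
  have := coarse_path Dc (q + r *: x) ((r * S) *: v) k.
  rewrite (bilipschitz_xx _ Dab) addr0 scalerA -tauE.
  have -> : \sum_(i < k) D (q + r *: x + i%:R *: ((r * S) *: v))
              (q + r *: x + i.+1%:R *: ((r * S) *: v)) =
            \sum_(i < k) D (pt i + r *: x) (pt i + r *: (x + S *: v)).
    apply: eq_bigr => i _; congr D; first by rewrite /pt scalerA addrAC.
    rewrite /pt scalerDr !scalerA -natr1 mulrDl mul1r scalerDl.
    by rewrite -!addrA; congr (_ + _); rewrite addrCA addrA.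
  have := coarse_triangle Dc (q + r *: x) q (q + tau *: v).
  have := coarse_triangle Dc (q + r *: x + tau *: v) (q + r *: x) (q + tau *: v).
  have /andP[_] := Dab q (q + r *: x).
  have /andP[_] := Dab (q + r *: x + tau *: v) (q + tau *: v).
  have -> : q + r *: x + tau *: v - (q + tau *: v) = r *: x.
    by apply/eqP; rewrite subr_eq addrA (addrC (r *: x) q).
  have -> : q - (q + r *: x) = - (r *: x) by rewrite opprD addNKr.
  rewrite normrN normrZ (gtr0_norm r0).
  move: qtau; rewrite tauE; lra.
(* Among the [k] pieces, one has a defect, summed over all of [s], not above the mean. *)
have [i ik iP] : exists2 i, (i < k)%N &
    \sum_(x <- s) defect i x <= 3 * M * e1 * (r * S) + 2 * b * r * B / k%:R.
  apply: le_sum_exists => //; rewrite exchange_big /=.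
  apply: le_trans (ler_sum _ (fun x _ => sum_defect x)) _.
  rewrite big_split /= big_const_seq count_predT iter_addr_0.
  have -> : \sum_(x <- s) 2 * b * r * `|x| = 2 * b * r * B by rewrite mulr_sumr.
  rewrite -(mulr_natl _ (size s)).
  have -> : k%:R * (3 * M * e1 * (r * S) + 2 * b * r * B / k%:R) =
    M * (k%:R * (3 * e1 * (r * S))) + 2 * b * r * B by field; rewrite gt_eqF.
  rewrite lerD2r; apply: ler_wpM2r; last by rewrite /M lerDl.
  by rewrite ltW // !(mulr_gt0, invr_gt0).
exists (pt i), r; split => // [x t t0|x xs].
  rewrite ler_pdivrMl // scalerDr addrA scalerA.
  apply: le_trans (C1P _ _ _) _; first by rewrite mulr_ge0 // ltW.
  have : e1 * (r * t) <= e * (r * t) by rewrite ler_wpM2r // mulr_ge0 // ltW.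
  move: C1e; lra.
rewrite ler_pdivlMl //.
have : defect i x <= \sum_(x <- s) defect i x.
  rewrite (perm_big _ (perm_to_rem xs)) big_cons /= lerDl.
  by apply: sumr_ge0.
move/le_trans => /(_ _ iP); rewrite /defect.
have h1 : 2 * b * r * B / k%:R <= e / 3 * r.
  rewrite ler_pdivrMr //.
  have : 6 * b * B * r <= k%:R * e * r by rewrite ler_wpM2r // ltW.
  lra.
have h2 : 9 * M * S * e1 * r <= e * r by rewrite ler_wpM2r // ltW.
have h3 : 0 <= e1 * (r * S) by rewrite ltW // !(mulr_gt0, invr_gt0).
have h4 : 0 < e * r by rewrite mulr_gt0.
move: h1 h2 h3 h4; lra.
Qed.

(** Rescalings that are almost exact along [v] on growing finite sets and lengths have an exact
    ultralimit. Exactness along other directions is not destroyed, so directions can be treated one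
    after the other. *)
Lemma exact_along_step D v : coarsely_realized X D ->
  bilipschitz_metric a b D -> 0 <= a -> 0 <= b -> exists D', [/\
    coarsely_realized X D', bilipschitz_metric a b D', exact_along D' v &
    forall w, exact_along D w -> exact_along D' w].
Proof.
move=> Dc Dab a0 b0; have [c [c0 cP]] := near_exact_rescaling v Dc Dab a0 b0.
have [U [UU Ux Um]] := @finite_subsets_ultrafilter V.
pose h (i : seq V * nat) : R := i.2.+1%:R.
have h0 i : 0 < h i by rewrite ltr0n.
have hh i : (h i)^-1 / h i <= (h i)^-1.
  by apply: ler_piMr; rewrite ?invr_ge0 ?ler0n // invf_le1 ?ler1n.
(* The error [(h i)^-1 / h i] still tends to 0 after multiplication by the length [h i]. *)
have pr i : exists u : V * R, [/\ 0 < u.2,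
    forall x t, 0 <= t -> u.2^-1 * D (u.1 + u.2 *: x) (u.1 + u.2 *: (x + t *: v))
      <= (c + (h i)^-1 / h i) * t + (h i)^-1 / h i &
    forall x, x \in i.1 -> c * h i - (h i)^-1 / h i <=
      u.2^-1 * D (u.1 + u.2 *: x) (u.1 + u.2 *: (x + h i *: v))].
  have [|p [r [? ? ?]]] := cP i.1 (h i) ((h i)^-1 / h i) (h0 i).
    by rewrite divr_gt0 // invr_gt0.
  by exists (p, r).
have {pr} [pr prP] := choice pr.
pose D_ i x y := (pr i).2^-1 * D ((pr i).1 + (pr i).2 *: x) ((pr i).1 + (pr i).2 *: y).
have Dic i : coarsely_realized X (D_ i).
  by apply: coarse_rescale => //; have [] := prP i.
have Diab i : bilipschitz_metric a b (D_ i).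
  by apply: bilipschitz_rescale => //; have [] := prP i.
have [D' D'P] := bilipschitz_ultralimit UU Diab.
exists D'; split.
- exact: (ultra_coarse UU D'P).
- exact: (ultra_bilipschitz UU D'P).
- suff D'v x t : 0 <= t -> D' x (x + t *: v) = t * c.
    move=> x t t0; rewrite D'v //; congr (_ * _).
    by have := D'v 0 1 ler01; rewrite add0r scale1r mul1r.
  move=> t0; apply/eqP; rewrite eq_le; apply/andP; split; apply/ler_addgt0Pr => e e0.
    have e1 : 0 < e / (t + 1) by rewrite divr_gt0 // ltr_wpDl.
    apply: (cvgr_to_le (@D'P x (x + t *: v))).
    apply: filterS (ultra_nat_infty UU Um e1) => i; rewrite -/(h i) => hi.
    have [_ /(_ x t t0) + _] := prP i; rewrite -/(D_ i x _); move/le_trans; apply.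
    have : (h i)^-1 / h i * (t + 1) <= e / (t + 1) * (t + 1).
      by rewrite ler_wpM2r ?addr_ge0 //; exact: le_trans (hh i) hi.
    rewrite divfK ?gt_eqF ?ltr_wpDl //; move: (_ / h i) => H; lra.
  rewrite -lerBlDr; apply: (cvgr_to_ge (@D'P x (x + t *: v))).
  have e3 : 0 < e / 3 by lra.
  (* Lower bound at length [t]: from the almost exact value at length [h i], subtract the upper
     bound for the remaining length [h i - t]. *)
  near=> i.
  have th : t <= h i.
    apply: ltW; apply: lt_le_trans (truncnS_gt t) _; rewrite ler_nat ltnS.
    by near: i; exact: Um.
  have xi : x \in i.1 by near: i; exact: Ux.
  have he : (h i)^-1 <= e / 3 by near: i; exact: ultra_nat_infty.
  have [_ + /(_ x xi)] := prP i; rewrite -/(D_ i x _).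
  have ht0 : 0 <= h i - t by rewrite subr_ge0.
  move=> /(_ (x + t *: v) _ ht0); rewrite -addrA -scalerDl (addrC t) subrK.
  rewrite -/(D_ i _ _).
  have := coarse_triangle (Dic i) (x + t *: v) x (x + h i *: v).
  have hh1 : (h i)^-1 / h i <= e / 3 by exact: le_trans (hh i) he.
  have hh2 : (h i)^-1 / h i * h i <= e / 3 by rewrite divfK // gt_eqF.
  have hh3 : 0 <= (h i)^-1 / h i * t by rewrite !mulr_ge0 // invr_ge0 ltW.
  move: hh1 hh2 hh3; move: (_ / h i) => H; lra.
- move=> w Dw; apply: (ultra_exact_along UU D'P); apply: (@filterE _ U) => i.
  by apply: exact_along_rescale => //; have [] := prP i.
Unshelve. all: by end_near. Qed.

Lemma exact_along_seq D (vs : seq V) : coarsely_realized X D ->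
  bilipschitz_metric a b D -> 0 <= a -> 0 <= b -> exists D', [/\
    coarsely_realized X D', bilipschitz_metric a b D' &
    forall v, v \in vs -> exact_along D' v].
Proof.
move=> Dc Dab a0 b0; elim: vs => [|v vs [D1 [D1c D1ab D1vs]]]; first by exists D.
have [D2 [D2c D2ab D2v D2w]] := exact_along_step v D1c D1ab a0 b0.
exists D2; split => // w; rewrite inE => /predU1P[-> //|/D1vs]; exact: D2w.
Qed.

(** An ultralimit over finite sets of directions is exact along every direction. Exactness along
    [y - x] with [t = 1] gives translation invariance, general [t] gives homogeneity, and [a > 0]
    gives definiteness. *)
Theorem coarse_metric_differentiation D : coarsely_realized X D ->
  bilipschitz_metric a b D -> 0 < a -> 0 <= b -> exists N : V -> R,
    is_norm N /\ coarsely_realized X (fun x y => N (x - y)).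
Proof.
move=> Dc Dab a0 b0.
have [U [UU Ux _]] := @finite_subsets_ultrafilter V.
have Ds (i : seq V * nat) : exists D', [/\ coarsely_realized X D',
    bilipschitz_metric a b D' & forall v, v \in i.1 -> exact_along D' v].
  exact: exact_along_seq i.1 Dc Dab (ltW a0) b0.
have {Ds} [D_ D_P] := choice Ds.
have Dic i : coarsely_realized X (D_ i) by have [] := D_P i.
have Diab i : bilipschitz_metric a b (D_ i) by have [] := D_P i.
have [D' D'P] := bilipschitz_ultralimit UU Diab.
have D'c := ultra_coarse UU D'P Dic.
have D'ab := ultra_bilipschitz UU D'P Diab.
have D'v v : exact_along D' v.
  apply: (ultra_exact_along UU D'P); apply: filterS (Ux v) => i.
  by have [_ _] := D_P i; apply.
pose N x := D' 0 x.
have NE x y : D' x y = N (y - x).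
  by have := D'v (y - x) x 1 ler01; rewrite scale1r mul1r addrC subrK.
have NN x : N (- x) = N x by rewrite /N (coarse_sym D'c) NE sub0r opprK.
exists N; split; last first.
  have -> : (fun x y => N (x - y)) = D' => //.
  by apply/funext => x; apply/funext => y; rewrite NE -opprB NN.
split => [x y|t x|x Nx].
- apply: le_trans (coarse_triangle D'c x _ _) _.
  by rewrite (NE x) (addrAC x) subrr add0r.
- have pos s : 0 <= s -> N (s *: x) = s * N x.
    by move=> s0; have := D'v x 0 s s0; rewrite add0r.
  have [t0|t0] := leP 0 t; first by rewrite ger0_norm // pos.
  by rewrite ltr0_norm // -NN -scaleNr pos // oppr_ge0 ltW.
- apply/eqP; rewrite -normr_le0 -(pmulr_rle0 _ a0) -Nx.
  by have /andP[+ _] := D'ab 0 x; rewrite sub0r normrN.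
Qed.

End MetricDifferentiation.

(** * Almost shift-invariant barycenters of cyclic tuples *)

Section Barycenters.
Context {R : realType} (X : metricType R) (sigma : X -> X -> R -> X).
Hypothesis sigmaP : bicombing sigma.
Implicit Types (x y : nat -> X) (p q : X).

Let mid p q := sigma p q 2^-1.

Let mid_le p q p' q' : mdist (mid p q) (mid p' q') <= (mdist p p' + mdist q q') / 2.
Proof.
apply: le_trans (bicombing_conical sigmaP _ _ _ _ _) _; first lra.
lra.
Qed.

Let midxx p : mid p p = p.
Proof.
apply: mdist_positivity.
have := @bicombing_geodesic _ _ _ sigmaP p p 2^-1 0.
by rewrite (bicombing0 sigmaP) mdistxx mulr0; apply; lra.
Qed.

Let mid_le_point p q z : mdist (mid p q) z <= (mdist p z + mdist q z) / 2.
Proof. by rewrite -{1}(midxx z); exact: mid_le. Qed.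

(** Periodic sequences encode cyclic tuples. As [mid] need not be symmetric, only consecutive
    entries in order are combined, which commutes with the index shift. *)
Definition midpoints x : nat -> X := fun i => mid (x i) (x i.+1).
Local Notation T := midpoints.

Lemma iter_midpoints_le x y c k : (forall i, mdist (x i) (y i) <= c) ->
  forall i, mdist (iter k T x i) (iter k T y i) <= c.
Proof.
move=> xy; elim: k => //= k IH i.
apply: le_trans (mid_le _ _ _ _) _; have := IH i; have := IH i.+1; lra.
Qed.

Lemma iter_midpoints_le_point x q c k : (forall i, mdist (x i) q <= c) ->
  forall i, mdist (iter k T x i) q <= c.
Proof.
move=> xq; elim: k => //= k IH i.
apply: le_trans (mid_le_point _ _ _) _; have := IH i; have := IH i.+1; lra.
Qed.

(** [iter k T x i] is an iterated midpoint in which each entry from [x i] to [x (i + k)] has weight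
    at least [2 ^- k], so one entry closer to [q] by [s] is felt with that weight. *)
Lemma iter_midpoints_gap x q c s j k i : (forall i, mdist (x i) q <= c) ->
  mdist (x j) q <= c - s -> (i <= j <= i + k)%N ->
  mdist (iter k T x i) q <= c - s / 2 ^+ k.
Proof.
move=> xq xj; elim: k i => [|k IH] i.
  by rewrite addn0 -eqn_leq => /eqP ->; rewrite divr1.
move=> /andP[ij]; rewrite addnS leq_eqVlt ltnS => /orP[/eqP jE|jik].
  have /IH : (i.+1 <= j <= i.+1 + k)%N by rewrite jE addSn leqnn ltnS leq_addr.
  move=> h; apply: le_trans (mid_le_point _ _ _) _.
  have := iter_midpoints_le_point k xq i; rewrite exprS invfM.
  by move: h; move: (2 ^- k) => H; lra.
have /IH h : (i <= j <= i + k)%N by rewrite ij.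
apply: le_trans (mid_le_point _ _ _) _.
have := iter_midpoints_le_point k xq i.+1; rewrite exprS invfM.
by move: h; move: (2 ^- k) => H; lra.
Qed.

Definition periodic (m : nat) x := forall i, x (i + m)%N = x i.

Lemma iter_midpoints_periodic m x k : periodic m x -> periodic m (iter k T x).
Proof.
by move=> xm; elim: k => //= k IH i; rewrite /midpoints -addSn !IH.
Qed.

Lemma periodic_mul m x k : periodic m x -> x (k * m)%N = x 0%N.
Proof. by move=> xm; elim: k => // k IH; rewrite mulSn addnC xm. Qed.

(* Every index sees a multiple of the period within m steps, so all entries of
   [iter m T x] are pulled towards [x 0] by a definite amount. *)
Lemma iter_midpoints_contract m x D : (0 < m)%N -> periodic m x ->
  (forall i j, mdist (x i) (x j) <= D) ->
  forall i j, mdist (iter m T x i) (iter m T x j) <= (1 - 4 ^- m) * D.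
Proof.
move=> m0 xm xD i j.
have near0 k : exists2 l, (k <= l <= k + m)%N & x l = x 0%N.
  exists ((k %/ m).+1 * m)%N; last exact: periodic_mul.
  rewrite mulSn; apply/andP; split; last by rewrite addnC leq_add2r leq_trunc_div.
  by rewrite {1}(divn_eq k m) addnC leq_add2r ltnW ?ltn_pmod.
have to0 k : mdist (iter m T x k) (x 0%N) <= D - D / 2 ^+ m.
  have [l kl xl] := near0 k.
  by apply: (iter_midpoints_gap _ _ kl) => //; rewrite xl mdistxx subrr.
have [l jl xl] := near0 i.
have q k : mdist (x k) (iter m T x j) <= D.
  by rewrite metric_sym; apply: iter_midpoints_le_point.
(* The gap lemma is applied a second time with [s = D / 2 ^+ m], the gain obtained in [to0]. *)
have -> : (1 - 4 ^- m) * D = D - D / 2 ^+ m / 2 ^+ m.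
  by rewrite mulrBl mul1r -mulrA -invfM -exprMn mulrC; congr (_ - _ / _ ^+ _); ring.
by apply: (iter_midpoints_gap q _ jl); rewrite xl metric_sym.
Qed.

(** By conicality a midpoint distance is at most the mean of two neighbouring distances, and
    periodicity makes the shifted sum equal to the original one. *)
Lemma iter_midpoints_sum m x y k : periodic m x -> periodic m y ->
  \sum_(i < m) mdist (iter k T x i) (iter k T y i) <= \sum_(i < m) mdist (x i) (y i).
Proof.
move=> xm ym; elim: k => //= k IH; apply: le_trans IH.
have /= xk := iter_midpoints_periodic k xm; have /= yk := iter_midpoints_periodic k ym.
move: (iter k T x) (iter k T y) xk yk => {xm ym}x {}y xm ym.
apply: le_trans (ler_sum _ (fun i _ => mid_le _ _ _ _)) _.
rewrite -mulr_suml big_split /=.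
suff -> : \sum_(i < m) mdist (x i.+1) (y i.+1) = \sum_(i < m) mdist (x i) (y i) by lra.
case: m xm ym => [|m] xm ym; first by rewrite !big_ord0.
rewrite big_ord_recr big_ord_recl /= addrC; congr (_ + _).
by rewrite -(xm 0%N) -(ym 0%N) add0n.
Qed.

(** After enough midpoint steps a periodic sequence is almost constant, so its entry at 0 nearly
    agrees with every other entry and is nearly unchanged by shifts. *)
Lemma exists_cyclic_barycenter (m : nat) (D e : R) : (0 < m)%N -> 0 < e ->
  exists b : (nat -> X) -> X, [/\
    forall x y c, (forall i, mdist (x i) (y i) <= c) -> mdist (b x) (b y) <= c,
    forall x q c, (forall i, mdist (x i) q <= c) -> mdist (b x) q <= c,
    forall x y, periodic m x -> periodic m y ->
      (forall i j, mdist (x i) (x j) <= D) -> (forall i j, mdist (y i) (y j) <= D) ->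
      mdist (b x) (b y) <= (\sum_(i < m) mdist (x i) (y i)) / m%:R + e &
    forall x, periodic m x -> (forall i j, mdist (x i) (x j) <= D) ->
      mdist (b x) (b (fun i => x i.+1)) <= e].
Proof.
move=> m0 e0.
(* [K] depends on [m], [D] and [e] only: [r] rounds of [m] steps contract the bound on distances by
   [th ^+ r]. *)
have [K KP] : exists K, forall x, periodic m x ->
    (forall i j, mdist (x i) (x j) <= D) ->
    forall i j, mdist (iter K T x i) (iter K T x j) <= e / 2.
  pose th : R := 1 - 4 ^- m.
  have th1 : `|th| < 1.
    have : 0 < 4 ^- m :> R by rewrite invr_gt0 exprn_gt0.
    have : 4 ^- m <= 1 :> R by rewrite invf_le1 ?exprn_gt0 // exprn_ege1 // ler1n.
    by rewrite /th ltr_norml; move: (4 ^- m) => H; lra.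
  have [r rP] : exists r, th ^+ r * D <= e / 2.
    have e1 : 0 < e / 2 / (`|D| + 1) by rewrite divr_gt0 //; lra.
    have /cvgrPdist_le/(_ _ e1)[r _ /(_ r (leqnn r))] := cvg_expr th1.
    rewrite /= sub0r normrN ler_pdivlMr ?ltr_wpDl // => h; exists r.
    apply: le_trans (ler_norm _) _; rewrite normrM; apply: le_trans h.
    by rewrite ler_wpM2l // lerDl.
  exists (r * m)%N => x xm xD i j; apply: le_trans rP.
  elim: r i j => [|r IH] i j; first by rewrite mul0n expr0 mul1r.
  rewrite mulSn iterD exprS -mulrA; apply: iter_midpoints_contract => //.
  exact: iter_midpoints_periodic.
exists (fun x => iter K T x 0%N); split.
- by move=> x y c xy; apply: iter_midpoints_le.
- by move=> x q c xy; apply: iter_midpoints_le_point.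
- move=> x y xm ym xD yD.
  have mR : 0 < m%:R :> R by rewrite ltr0n.
  (* After iteration every term of the sum is at least the distance of the entries at 0 minus [e],
     with [e / 2] lost in each tuple. *)
  rewrite -lerBlDr ler_pdivlMr //; apply: le_trans (iter_midpoints_sum K xm ym).
  rewrite mulr_natr -{1}(card_ord m) -sumr_const; apply: ler_sum => i _.
  have := KP x xm xD 0%N i; have := KP y ym yD i 0%N.
  have := metric_triangle (iter K T x 0%N) (iter K T x i) (iter K T y 0%N).
  have := metric_triangle (iter K T x i) (iter K T y i) (iter K T y 0%N).
  lra.
- move=> x xm xD.
  have sh k i : iter k T (fun i => x i.+1) i = iter k T x i.+1.
    by elim: k i => //= k IH i; rewrite /midpoints !IH.
  by rewrite sh; apply: le_trans (KP x xm xD _ _) _; lra.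
Qed.

End Barycenters.

(** * Elementary properties of norms *)

Section NormFacts.
Context {R : realType} (V : lmodType R) (N : V -> R) (NP : is_norm N).

Lemma is_norm0 : N 0 = 0.
Proof. by rewrite -(scale0r 0) (is_norm_homogeneous NP) normr0 mul0r. Qed.

Lemma is_normN x : N (- x) = N x.
Proof. by rewrite -scaleN1r (is_norm_homogeneous NP) normrN1 mul1r. Qed.

Lemma is_norm_ge0 x : 0 <= N x.
Proof.
have := is_norm_triangle NP x (- x); rewrite subrr is_norm0 is_normN; lra.
Qed.

Lemma is_norm_natmul (k : nat) x : N (k%:R *: x) = k%:R * N x.
Proof. by rewrite (is_norm_homogeneous NP) normr_nat. Qed.

Lemma is_normB x y : N (x - y) = N (y - x).
Proof. by rewrite -opprB is_normN. Qed.

Lemma is_norm_dist z x y : N (x - y) <= N (x - z) + N (z - y).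
Proof. by have := is_norm_triangle NP (x - z) (z - y); rewrite addrA subrK. Qed.

End NormFacts.

(** * Smoothing a map along finitely many directions *)

Section Smoothing.
Context {R : realType} (X : metricType R) (sigma : X -> X -> R -> X).
Hypothesis sigmaP : bicombing sigma.
Context (V : lmodType R) (N : V -> R) (NP : is_norm N).
Implicit Types (F : V -> X) (u v x y : V) (r w c : R).
Variables (m : nat) (D e : R).
Hypotheses (m_gt0 : (0 < m)%N) (e_gt0 : 0 < e).

Let mR : 0 < m%:R :> R. Proof. by rewrite ltr0n. Qed.

(* The tuple attached to [x + v] is the cyclic shift of the tuple attached to [x],
   except that the entry [F x] is replaced by [F (x + m%:R *: v)]. *)
Lemma directional_smoothing v : exists A : (V -> X) -> V -> X,
  forall F r w, m%:R * N v <= w -> [/\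
    forall u c, (forall x, N x <= r + w -> mdist (F x) (F (x + u)) <= c) ->
      forall x, N x <= r -> mdist (A F x) (A F (x + u)) <= c,
    forall c, (forall x, N x <= r + w -> forall i, (i < m)%N ->
        mdist (F x) (F (x + i%:R *: v)) <= c) ->
      forall x, N x <= r -> mdist (A F x) (F x) <= c,
    (forall x y, N x <= r + w -> N y <= r + w -> mdist (F x) (F y) <= D) ->
      forall x y, N x <= r -> N y <= r -> mdist (A F x) (A F y) <= D &
    forall c, (forall x y, N x <= r + w -> N y <= r + w -> mdist (F x) (F y) <= D) ->
      (forall x, N x <= r + w -> mdist (F x) (F (x + m%:R *: v)) <= c) ->
      forall x, N x <= r -> mdist (A F x) (A F (x + v)) <= c / m%:R + e].
Proof.
have e2 : 0 < e / 2 by rewrite divr_gt0.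
have [b [b_le b_pt b_sum b_shift]] := exists_cyclic_barycenter sigmaP D m_gt0 e2.
pose t F x (i : nat) := F (x + (i %% m)%:R *: v).
have t_per F x : periodic m (t F x) by move=> i; rewrite /t modnDr.
exists (fun F x => b (t F x)) => F r w vw.
have dom x (i : nat) : (i <= m)%N -> N x <= r -> N (x + i%:R *: v) <= r + w.
  move=> im xr; apply: le_trans (is_norm_triangle NP _ _) _; apply: lerD => //.
  rewrite (is_norm_natmul NP); apply: le_trans vw.
  by rewrite ler_wpM2r ?(is_norm_ge0 NP) // ler_nat.
have domt x i : N x <= r -> N (x + (i %% m)%:R *: v) <= r + w.
  by apply: dom; rewrite ltnW // ltn_pmod.
split.
- by move=> u c Fu x xr; apply: b_le => i; rewrite /t addrAC; apply/Fu/domt.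
- have w0 : 0 <= w by apply: le_trans vw; rewrite mulr_ge0 ?(is_norm_ge0 NP).
  move=> c Fc x xr; apply: b_pt => i; rewrite /t metric_sym; apply: Fc.
    by apply: le_trans xr _; rewrite lerDl.
  by rewrite ltn_pmod.
- by move=> FD x y xr yr; apply: b_le => i; apply: FD; exact: domt.
- move=> c FD Fc x xr.
  have tD i j : mdist (t F x i) (t F x j) <= D by apply: FD; exact: domt.
  have shE i : t F (x + v) i = F (x + (i %% m).+1%:R *: v).
    by rewrite /t -natr1 scalerDl scale1r -addrA (addrC v).
  have tD' i j : mdist (t F (x + v) i) (t F (x + v) j) <= D.
    by rewrite !shE; apply: FD; apply: dom => //; rewrite ltn_pmod.
  have w0 : 0 <= w by apply: le_trans vw; rewrite mulr_ge0 ?(is_norm_ge0 NP).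
  have Fx : mdist (F x) (F (x + m%:R *: v)) <= c.
    by apply: Fc; apply: le_trans xr _; rewrite lerDl.
  have s1 := b_shift _ (t_per F x) tD.
  have sper : periodic m (fun i => t F x i.+1) by move=> i; rewrite -addSn t_per.
  have s2 := b_sum _ _ sper (t_per F (x + v)) (fun i j => tD i.+1 j.+1) tD'.
  apply: le_trans (metric_triangle _ (b (fun i => t F x i.+1)) _) _.
  have : (\sum_(i < m) mdist (t F x i.+1) (t F (x + v) i)) / m%:R <= c / m%:R.
    rewrite ler_pM2r ?invr_gt0 //; apply: le_trans Fx.
    case: (m) m_gt0 @t {t_per tD shE tD' s1 sper s2} => // k _ t; rewrite big_ord_recr /= big1 => [|i _].
      rewrite add0r /t modnn scale0r addr0 modn_small //.
      by rewrite -natr1 scalerDl scale1r -addrA (addrC v).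
    rewrite /t !modn_small ?ltnS ?(ltnW (ltn_ord i)) //.
    by rewrite -natr1 scalerDl scale1r -addrA (addrC v) mdistxx.
  by move: s1 s2; lra.
Qed.

(** Smoothing preserves every bound on [mdist (F x) (F (x + u))], so the gain along one direction
    survives the smoothing along the others. Each direction shrinks the radius of validity by
    [w]. *)
Lemma multidirectional_smoothing (vs : seq V) w :
  (forall v, v \in vs -> m%:R * N v <= w) -> 0 <= w ->
  exists A : (V -> X) -> V -> X, forall F r, let r' := r + (size vs)%:R * w in [/\
    forall u c, (forall x, N x <= r' -> mdist (F x) (F (x + u)) <= c) ->
      forall x, N x <= r -> mdist (A F x) (A F (x + u)) <= c,
    forall c, (forall v, v \in vs -> forall x, N x <= r' ->
        forall i, (i < m)%N -> mdist (F x) (F (x + i%:R *: v)) <= c) ->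
      forall x, N x <= r -> mdist (A F x) (F x) <= (size vs)%:R * c &
    forall c : V -> R,
      (forall x y, N x <= r' -> N y <= r' -> mdist (F x) (F y) <= D) ->
      (forall v, v \in vs -> forall x, N x <= r' ->
        mdist (F x) (F (x + m%:R *: v)) <= c v) ->
      forall v, v \in vs -> forall x, N x <= r ->
        mdist (A F x) (A F (x + v)) <= c v / m%:R + e].
Proof.
move=> vsw w0; elim: vs vsw => [_|v vs IH vsw].
  exists id => F r /=; rewrite mul0r addr0; split => // c _ x _.
  by rewrite mdistxx mul0r.
have [|A AP] := IH; first by move=> u uvs; apply: vsw; rewrite inE uvs orbT.
have [B BP] := directional_smoothing v.
have vw : m%:R * N v <= w by apply: vsw; rewrite mem_head.
exists (fun F => A (B F)) => F r /=.
have -> : r + (size vs).+1%:R * w = r + (size vs)%:R * w + w.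
  by rewrite -natr1; ring.
have [Ba Bb Bd Bc] := BP F (r + (size vs)%:R * w) w vw.
have [Aa Ab Ac] := AP (B F) r.
have sub x : N x <= r -> N x <= r + (size vs)%:R * w.
  by move=> xr; apply: le_trans xr _; rewrite lerDl mulr_ge0.
split.
- by move=> u c Fu; apply: Aa; apply: Ba.
- move=> c Fc x xr; apply: le_trans (metric_triangle _ (B F x) _) _.
  rewrite -natr1 mulrDl mul1r; apply: lerD.
    apply: Ab => // u uvs y yr i im; apply: Ba => // z zr.
    by apply: Fc => //; rewrite inE uvs orbT.
  apply: Bb; last exact: sub.
  by move=> y yr i im; apply: Fc => //; rewrite mem_head.
- move=> c FD Fc u; rewrite inE => /predU1P[->|uvs].
    by apply: Aa; apply: Bc => //; apply: Fc; rewrite mem_head.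
  apply: Ac => //; first exact: Bd.
  move=> z zvs; apply: Ba; apply: Fc; by rewrite inE zvs orbT.
Qed.

End Smoothing.

(** * Averages along lines and simultaneous good points *)

Section Averaging.
Context {R : realType} (V : lmodType R) (N : V -> R) (NP : is_norm N).
Implicit Types (f g : V -> R) (v x y : V).
Variables (k : nat) (w : R).
Hypothesis k_gt0 : (0 < k)%N.

Let kR : 0 < k%:R :> R. Proof. by rewrite ltr0n. Qed.

Definition line_average v f x : R := k%:R^-1 * \sum_(i < k) f (x + i%:R *: v).

Definition lines_average (vs : seq V) f : V -> R := foldr line_average f vs.

Let dom r v x (i : 'I_k) : k%:R * N v <= w -> N x <= r -> N (x + i%:R *: v) <= r + w.
Proof.
move=> vw xr; apply: le_trans (is_norm_triangle NP _ _) _; apply: lerD => //.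
rewrite (is_norm_natmul NP); apply: le_trans vw.
by rewrite ler_wpM2r ?(is_norm_ge0 NP) // ler_nat ltnW.
Qed.

Lemma line_average_le v f r c : k%:R * N v <= w ->
  (forall x, N x <= r + w -> f x <= c) -> forall x, N x <= r -> line_average v f x <= c.
Proof.
move=> vw fc x xr; rewrite /line_average ler_pdivrMl //.
rewrite -[X in X%:R * c](card_ord k) mulr_natl -sumr_const; apply: ler_sum => i _.
by apply: fc; exact: dom.
Qed.

Lemma line_average_comm u v f :
  line_average u (line_average v f) = line_average v (line_average u f).
Proof.
apply/funext => x; rewrite /line_average; congr (_ * _).
rewrite -!mulr_sumr exchange_big /=; congr (_ * _).
by apply: eq_bigr => i _; apply: eq_bigr => j _; rewrite addrAC.
Qed.

(** Line averages commute, so the one along [v] can be taken first; the others then average values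
    at most [c]. *)
Lemma lines_average_le (vs : seq V) v f r c : 0 <= w ->
  (forall u, u \in vs -> k%:R * N u <= w) -> v \in vs ->
  (forall x, N x <= r + (size vs)%:R * w -> line_average v f x <= c) ->
  forall x, N x <= r -> lines_average vs f x <= c.
Proof.
move=> w0 vsw vvs fc.
have comm us : lines_average us (line_average v f) = line_average v (lines_average us f).
  by elim: us => //= u us ->; rewrite line_average_comm.
have mono us g r' : (forall u, u \in us -> k%:R * N u <= w) ->
    (forall x, N x <= r' + (size us)%:R * w -> g x <= c) ->
    forall x, N x <= r' -> lines_average us g x <= c.
  elim: us r' => [|u us IH] r' usw gc /=; first by move: gc; rewrite mul0r addr0.
  apply: line_average_le; first by apply: usw; rewrite mem_head.
  apply: IH => [z zus|x xr]; first by apply: usw; rewrite inE zus orbT.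
  by apply: gc; apply: le_trans xr _; rewrite /= -natr1; lra.
elim: vs r vsw vvs fc => // u us IH r usw; rewrite inE => /predU1P[vu|vus] fc /=.
  rewrite -vu -comm; apply: mono.
    by move=> z zus; apply: usw; rewrite inE zus orbT.
  move=> x xr; apply: fc; apply: le_trans xr _; rewrite /= -natr1.
  by move: w0; lra.
apply: line_average_le; first by apply: usw; rewrite mem_head.
apply: IH => // [z zus|x xr]; first by apply: usw; rewrite inE zus orbT.
by apply: fc; apply: le_trans xr _; rewrite /= -natr1; lra.
Qed.

Lemma lines_average_exists (vs : seq V) f c r :
  (forall u, u \in vs -> k%:R * N u <= w) ->
  forall x, N x <= r -> lines_average vs f x <= c ->
  exists2 y, N y <= r + (size vs)%:R * w & f y <= c.
Proof.
elim: vs r => [|u us IH] r usw x xr /=; first by exists x; rewrite ?mul0r ?addr0.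
rewrite /line_average ler_pdivrMl // => sumP.
have [i ik iP] := le_sum_exists (f := fun i => lines_average us f (x + i%:R *: u)) k_gt0 sumP.
have [||y yr fy] := IH (r + w) _ _ _ iP.
- by move=> z zus; apply: usw; rewrite inE zus orbT.
- by apply: (dom (Ordinal ik)) => //; apply: usw; rewrite mem_head.
by exists y => //; apply: le_trans yr _; rewrite -natr1; lra.
Qed.

Lemma lines_average_sum (vs : seq V) (I : Type) (s : seq I) (f : I -> V -> R) x :
  lines_average vs (fun y => \sum_(j <- s) f j y) x =
  \sum_(j <- s) lines_average vs (f j) x.
Proof.
elim: vs x => //= v vs IH x; rewrite /line_average -mulr_sumr; congr (_ * _).
by rewrite exchange_big /=; apply: eq_bigr => i _.
Qed.

(** The iterated average over all directions bounds the sum of the [f j] by [(size s)%:R * c] at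
    some point; the terms being nonnegative, each obeys the same bound there. *)
Lemma simultaneous_average (I : eqType) (s : seq I) (v : I -> V)
    (f : I -> V -> R) (c : R) : 0 <= w ->
  (forall j, j \in s -> k%:R * N (v j) <= w) ->
  (forall j, j \in s -> forall x, N x <= (size s)%:R * w ->
    0 <= f j x /\ line_average (v j) (f j) x <= c) ->
  exists2 x, N x <= (size s)%:R * w & forall j, j \in s -> f j x <= (size s)%:R * c.
Proof.
move=> w0 sw sc; pose vs := [seq v j | j <- s].
have vsw u : u \in vs -> k%:R * N u <= w by move=> /mapP[j js ->]; exact: sw.
have N0 : N 0 <= 0 by rewrite (is_norm0 NP).
have [|x] := @lines_average_exists vs (fun y => \sum_(j <- s) f j y)
  ((size s)%:R * c) 0 vsw 0 N0.
  rewrite lines_average_sum.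
  have -> : (size s)%:R * c = \sum_(j <- s) c.
    by rewrite big_const_seq count_predT iter_addr_0 mulr_natl.
  rewrite !big_seq; apply: ler_sum => j js.
  apply: (@lines_average_le vs (v j) (f j) 0) => //; first exact: map_f.
  by move=> x; rewrite add0r size_map => xs; have [] := sc j js x xs.
rewrite add0r size_map => xs sx; exists x => // j js.
apply: le_trans sx; rewrite (perm_big _ (perm_to_rem js)) big_cons /= lerDl.
rewrite big_seq; apply: sumr_ge0 => l /mem_rem ls.
by have [] := sc l ls x xs.
Qed.

End Averaging.

(** * Compactness and equivalence of norms on row vectors *)

Section FiniteDimension.
Context {R : realType} (n : nat).
Implicit Types x y : 'rV[R]_n.

Lemma rV_coord_le x i : `|x ord0 i| <= `|x|.
Proof.
rewrite [`|x|](mx_normrE x).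
exact: (le_bigmax _ (fun ij : 'I_1 * 'I_n => `|x ij.1 ij.2|) (ord0, i)).
Qed.

Lemma rV_norm_le x c : 0 <= c -> (forall i, `|x ord0 i| <= c) -> `|x| <= c.
Proof.
move=> c0 xc; rewrite [`|x|](mx_normrE x); apply: bigmax_le => // -[i j] _ /=.
by rewrite (ord1 i).
Qed.

Lemma rV_ball_compact c : 0 <= c -> compact [set x : 'rV[R]_n | `|x| <= c].
Proof.
move=> c0; have -> : [set x : 'rV[R]_n | `|x| <= c] =
    [set x : 'rV[R]_n | forall i, `[- c, c]%classic (x ord0 i)].
  apply/seteqP; split => x /= xc.
    by move=> i; rewrite in_itv /= -ler_norml; exact: le_trans (rV_coord_le x i) xc.
  by apply: rV_norm_le => // i; have := xc i; rewrite in_itv /= -ler_norml.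
by apply: (@rV_compact _ n (fun=> `[- c, c]%classic)) => _; exact: segment_compact.
Qed.

Lemma rV_finite_net (c e : R) : 0 < e -> exists s : seq 'rV[R]_n,
  forall x, `|x| <= c -> exists2 y, y \in s & `|x - y| <= e.
Proof.
move=> e0; have [c0|c0] := ltP c 0.
  by exists [::] => x xc; have := le_trans (normr_ge0 x) xc; rewrite leNgt c0.
have := rV_ball_compact c0; rewrite compact_cover.
move=> /(_ _ setT (fun x => ball x e)) [i _||s _ cov].
- exact: ball_open.
- by move=> x _; exists x => //; exact: ballxx.
exists (finmap.enum_fset s) => x xc; have [y /= ys] := cov x xc.
by rewrite -ball_normE /= => xy; exists y => //; rewrite distrC ltW.
Qed.

Variables (N : 'rV[R]_n -> R) (NP : is_norm N).

Lemma is_norm_le_norm : exists2 C : R, 0 < C & forall x, N x <= C * `|x|.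
Proof.
exists (\sum_(i < n) N (delta_mx 0 i) + 1).
  by rewrite ltr_wpDl // sumr_ge0 // => i _; exact: is_norm_ge0.
move=> x; rewrite {1}(row_sum_delta x) mulrDl mul1r mulr_suml.
apply: (@le_trans _ _ (\sum_(i < n) N (delta_mx 0 i) * `|x|)); last by rewrite lerDl.
apply: (big_ind2 (fun (a : 'rV[R]_n) (b : R) => N a <= b)).
- by rewrite is_norm0.
- move=> a b a' b' ab ab'; apply: le_trans (is_norm_triangle NP _ _) _; exact: lerD.
move=> i _; rewrite (is_norm_homogeneous NP) mulrC.
by rewrite ler_wpM2l ?(is_norm_ge0 NP) // rV_coord_le.
Qed.

(** Otherwise sup-norm unit vectors with [N] tending to 0 would accumulate at a vector [l] with
    [N l = 0], that is at 0. *)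
Lemma norm_le_is_norm : exists2 C : R, 0 < C & forall x, `|x| <= C * N x.
Proof.
apply: contrapT => nC.
(* The first component of the index is a dummy that lets [finite_subsets_ultrafilter] supply the
   limit. *)
have sq (i : seq unit * nat) : exists x, `|x| = 1 /\ N x <= i.2.+1%:R^-1.
  apply: contrapT => nx; apply: nC; exists i.2.+1%:R => [|x]; first by rewrite ltr0n.
  have [->|x0] := eqVneq x 0; first by rewrite normr0 mulr_ge0 // is_norm_ge0.
  have nx0 : 0 < `|x| by rewrite normr_gt0.
  rewrite leNgt; apply/negP => xN; apply: nx; exists (`|x|^-1 *: x).
  rewrite normrZ (is_norm_homogeneous NP) ger0_norm ?invr_ge0 // mulVf ?gt_eqF //.
  split => //; rewrite ler_pdivrMl // ler_pdivlMr ?ltr0n //.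
  by rewrite mulrC ltW.
have [f fP] := choice sq.
have [U [UU _ Um]] := @finite_subsets_ultrafilter unit.
have [l fl] : exists l : 'rV[R]_n, f @ U --> l.
  apply: (ultra_cvg_compact UU (rV_ball_compact (@ler01 R))).
  by apply: (@filterE _ U) => i /=; have [-> _] := fP i.
have [C C0 NC] := is_norm_le_norm.
have l0 : l = 0.
  apply: (is_norm_definite NP); apply/eqP; rewrite eq_le (is_norm_ge0 NP) andbT.
  apply/ler_addgt0Pr => e e0; rewrite add0r.
  have e1 : 0 < e / 2 / C by rewrite !divr_gt0.
  have e2 : 0 < e / 2 by rewrite divr_gt0.
  have /cvgrPdist_le/(_ _ e1) le1 := fl.
  have [i [le2 le3]] := filter_ex (filterI le1 (ultra_nat_infty UU Um e2)).
  have := is_norm_triangle NP (l - f i) (f i); rewrite subrK => /le_trans; apply.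
  have [_ fi] := fP i; have := le_trans fi le3.
  have := NC (l - f i); move: le2; rewrite ler_pdivlMr // mulrC; lra.
have /cvgrPdist_lt/(_ _ (@ltr01 R))/filter_ex[i] := fl.
by rewrite l0 sub0r normrN; have [-> _] := fP i; rewrite ltxx.
Qed.

End FiniteDimension.

(** * Coarse isometries on large balls *)

Section UnitScale.
Context {R : realType} (n : nat) (X : metricType R).
Variables (N : 'rV[R]_n -> R) (NP : is_norm N).
Hypothesis N_coarse : coarsely_realized X (fun x y => N (x - y)).

(** A realization on a finite net of the [q]-ball extends by rounding to the net. The scale is
    rounded to an integer [m], which later is also the number of points of a barycenter. *)
Lemma coarse_norm_on_balls (q e : R) (T : nat) : 0 < e ->
  exists (m : nat) (F : 'rV[R]_n -> X), (T <= m)%N /\ forall x y,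
    N x <= q * m%:R -> N y <= q * m%:R ->
    `|mdist (F x) (F y) - N (x - y)| <= e * m%:R.
Proof.
move=> e0.
have [C C0 NC] := is_norm_le_norm NP; have [C' C'0 NC'] := norm_le_is_norm NP.
have d0 : 0 < e / 8 / C by rewrite !divr_gt0.
have [s sP] := rV_finite_net n (C' * q) d0.
have nearP x : exists y, N x <= q -> y \in s /\ N (x - y) <= e / 8.
  have [xq|] := leP (N x) q; last by exists 0.
  have [|y ys xy] := sP x; first by apply: le_trans (NC' x) _; rewrite ler_pM2l.
  by exists y => _; split => //; apply: le_trans (NC _) _; rewrite mulrC -ler_pdivlMr.
have [near nP] := choice nearP.
have e8 : 0 < e / 8 by rewrite divr_gt0.
(* The last term of the threshold makes the cost [2 * |q|] of replacing [l] by [m] at most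
   [e / 8 * m%:R]. *)
have [l [phi [Tl l0 phiP]]] :=
  N_coarse s (T.+1%:R + 1 + 16 * `|q| / e) e8.
pose m := Num.Def.trunc l.
have /andP[ml lm] := truncn_itv (ltW l0); rewrite -/m in ml lm.
rewrite -natr1 in lm.
have qe : 0 <= 16 * `|q| / e by rewrite divr_ge0 ?mulr_ge0 // ltW.
have Tm : (T.+1 <= m)%N by rewrite -(ler_nat R); move: Tl lm qe; rewrite -!natr1; lra.
have m0 : 0 < m%:R :> R by rewrite ltr0n; exact: leq_trans Tm.
exists m, (fun x => phi (near (m%:R^-1 *: x))); split => [|x y xm ym]; first exact: ltnW.
have xE (z : 'rV[R]_n) : z = m%:R *: (m%:R^-1 *: z) by rewrite scalerA mulfV ?scale1r // gt_eqF.
have sc z : N z <= q * m%:R -> N (m%:R^-1 *: z) <= q.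
  by rewrite (is_norm_homogeneous NP) gtr0_norm ?invr_gt0 // ler_pdivrMl // mulrC.
move/sc: xm => xm; move/sc: ym => ym.
rewrite {2}(xE x) {2}(xE y) -scalerBr is_norm_natmul //.
move: (m%:R^-1 *: x) (m%:R^-1 *: y) xm ym => {}x {}y xq yq {sc xE}.
have [xs xx] := nP x xq; have [ys yy] := nP y yq.
have hphi := phiP _ _ xs ys.
have d1 : `|N (near x - near y) - N (x - y)| <= e / 4.
  have := is_norm_dist NP x (near x) (near y).
  have := is_norm_dist NP y x (near y).
  have := is_norm_dist NP (near x) x y.
  have := is_norm_dist NP (near y) (near x) y.
  rewrite (is_normB NP (near x) x) (is_normB NP (near y) y) ler_norml; lra.
have d2 : N (x - y) <= 2 * `|q|.
  have := is_norm_triangle NP x (- y); rewrite is_normN //.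
  have := ler_norm q; lra.
have d2' := is_norm_ge0 NP (x - y).
have d3 : (l - m%:R) * N (x - y) <= 2 * `|q|.
  have := normr_ge0 q; nra.
have d4 : 0 <= (l - m%:R) * N (x - y) by rewrite mulr_ge0 // subr_ge0.
have d5 : 2 * `|q| <= e / 8 * m%:R.
  have : 16 * `|q| / e <= m%:R by move: Tl lm; rewrite -natr1; have := ler0n R T; lra.
  by rewrite ler_pdivrMr //; lra.
have d6 : l <= 2 * m%:R.
  have : 1 <= m%:R :> R by rewrite ler1n; exact: leq_trans Tm.
  lra.
have d7 : `|l * (N (near x - near y) - N (x - y))| <= e / 4 * l.
  by rewrite normrM gtr0_norm // mulrC ler_pM2r.
have d8 : e * l <= e * (2 * m%:R) by rewrite ler_pM2l.
move: hphi d7 d3 d4 d5 d8; rewrite !ler_norml; lra.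
Qed.

End UnitScale.

(** * Realizing the norm at scale 1 on finite sets *)

Section FiniteRealization.
Context {R : realType} (n : nat) (X : metricType R) (sigma : X -> X -> R -> X).
Hypothesis sigmaP : bicombing sigma.
Variables (N : 'rV[R]_n -> R) (NP : is_norm N).
Hypothesis N_coarse : coarsely_realized X (fun x y => N (x - y)).

Lemma mdist_path (g : nat -> X) (k : nat) :
  mdist (g 0%N) (g k) <= \sum_(i < k) mdist (g i) (g i.+1).
Proof.
elim: k => [|k IH]; first by rewrite big_ord0 mdistxx.
rewrite big_ord_recr /=; apply: le_trans (metric_triangle _ (g k) _) _.
by rewrite lerD2r.
Qed.

(** Two scales interact: [m] is the barycenter size, which makes the smoothed map [G] almost
    1-Lipschitz along differences of points of [U], and [k = Q * m] is the length over which the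
    distance from [G] to [F], linear in [m], becomes negligible. *)
Lemma norm_finitely_realized (U : seq 'rV[R]_n) (e : R) : 0 < e ->
  exists phi : 'rV[R]_n -> X, forall u u', u \in U -> u' \in U ->
    `|mdist (phi u) (phi u') - N (u - u')| <= e.
Proof.
move=> e0; pose J := allpairs pair U U.
pose v (j : 'rV[R]_n * 'rV[R]_n) := j.2 - j.1.
pose P : R := (size J)%:R; have P0 : 0 <= P by rewrite ler0n.
pose W : R := 2 * \sum_(u <- U) N u + 1.
have NU u : u \in U -> 2 * N u <= W - 1.
  move=> uU; rewrite /W addrK ler_pM2l // (perm_big _ (perm_to_rem uU)) big_cons /= lerDl.
  by apply: sumr_ge0 => z _; exact: is_norm_ge0.
have W1 : 1 <= W.
  by rewrite lerDr mulr_ge0 // sumr_ge0 // => z _; exact: is_norm_ge0.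
have W0 : 0 <= W by lra.
have JU j : j \in J -> j.1 \in U /\ j.2 \in U by move=> /allpairsP[[a b] [? ? ->]].
have NJ j : j \in J -> N (v j) <= W.
  move=> /JU[/NU h1 /NU h2].
  have := is_norm_triangle NP j.2 (- j.1); rewrite (is_normN NP) -/(v j); lra.
pose e1 : R := Num.min 1 (e / (4 * (P + 1))).
have e10 : 0 < e1 by rewrite lt_min ltr01 divr_gt0 // mulr_gt0 // ltr_wpDl.
have e11 : e1 <= 1 by rewrite ge_min lexx.
have e1P : 4 * (P * e1) + 4 * e1 <= e.
  have : e1 <= e / (4 * (P + 1)) by rewrite ge_min lexx orbT.
  rewrite ler_pdivlMr ?mulr_gt0 ?ltr_wpDl //; lra.
(* Makes the part of [P * c] divided by [Q] at most [e / 2] in [Pc]. *)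
pose Q := (Num.Def.trunc (2 * (P * (1 + 2 * (P * (W + 1)))) / e)).+1.
have QP : 2 * (P * (1 + 2 * (P * (W + 1)))) <= Q%:R * e.
  by rewrite -ler_pdivrMr // ltW // truncnS_gt.
have Q1 : 1 <= Q%:R :> R by rewrite ler1n.
have [m [F [m1 FP]]] := coarse_norm_on_balls NP N_coarse ((2 * P + 3) * (Q%:R * W)) 1 e10.
have mR : 0 < m%:R :> R by rewrite ltr0n.
have m1R : 1 <= m%:R :> R by rewrite ler1n.
pose wm := m%:R * W; pose k := (Q * m)%N; pose wk := k%:R * W.
have kE : k%:R = Q%:R * m%:R :> R by rewrite /k natrM.
have k0 : (0 < k)%N by rewrite muln_gt0.
have kR : 0 < k%:R :> R by rewrite ltr0n.
have wm0 : 0 <= wm by rewrite mulr_ge0.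
have wk0 : 0 <= wk by rewrite mulr_ge0.
have wmk : wm <= wk by rewrite ler_wpM2r // kE ler_peMl.
have Wwk : W <= wk by rewrite ler_peMl // ler1n.
(* The good point has norm at most [P * wk]; adding a point of [U] and then [k] steps stays within
   [r]. Smoothing widens this by [P * wm] and one run of [m] steps by [wm], all within
   [(2 * P + 3) * wk]. *)
pose r := (P + 2) * wk.
pose D := (2 * P + 3) * wk * 2 + e1 * m%:R.
have FP' x y : N x <= (2 * P + 3) * wk -> N y <= (2 * P + 3) * wk ->
    `|mdist (F x) (F y) - N (x - y)| <= e1 * m%:R.
  have -> : (2 * P + 3) * wk = (2 * P + 3) * (Q%:R * W) * m%:R.
    by rewrite /wk kE; ring.
  exact: FP.
have Pwk : P * wm <= P * wk by rewrite ler_wpM2l.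
have Pwk0 : 0 <= P * wk by rewrite mulr_ge0.
pose vs := [seq v j | j <- J].
have svs : (size vs)%:R = P by rewrite size_map.
have vsW u : u \in vs -> N u <= W by move=> /mapP[j jJ ->]; exact: NJ.
have vsm u : u \in vs -> m%:R * N u <= wm by move=> /vsW uW; rewrite ler_wpM2l // ltW.
have [A AP] := multidirectional_smoothing sigmaP NP D m1 e10 vsm wm0.
have [_ Ab Ac] := AP F r; rewrite svs in Ab Ac.
pose G := A F.
have steps x u (i : nat) : N x <= r + P * wm -> u \in vs -> (i <= m)%N ->
    mdist (F x) (F (x + i%:R *: u)) <= m%:R * N u + e1 * m%:R.
  move=> xr uvs im.
  have xr' : N x <= (2 * P + 3) * wk by apply: le_trans xr _; rewrite /r; lra.
  have h1 : i%:R * N u <= m%:R * N u by rewrite ler_wpM2r ?ler_nat ?(is_norm_ge0 NP).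
  have yr : N (x + i%:R *: u) <= (2 * P + 3) * wk.
    apply: le_trans (is_norm_triangle NP _ _) _; rewrite (is_norm_natmul NP).
    have := vsm u uvs; move: xr h1; rewrite /r; lra.
  have := FP' _ _ xr' yr; rewrite opprD addNKr (is_normN NP) (is_norm_natmul NP).
  by rewrite ler_norml; move: h1; lra.
have Gup u x : u \in vs -> N x <= r -> mdist (G x) (G (x + u)) <= N u + 2 * e1.
  move=> uvs xr.
  have := Ac (fun u => m%:R * N u + e1 * m%:R) _ _ u uvs x xr.
  have -> : (m%:R * N u + e1 * m%:R) / m%:R + e1 = N u + 2 * e1.
    by field; rewrite gt_eqF.
  apply=> [y z yr zr|z zvs y yr]; last exact: steps.
  have yr' : N y <= (2 * P + 3) * wk by apply: le_trans yr _; rewrite /r; lra.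
  have zr' : N z <= (2 * P + 3) * wk by apply: le_trans zr _; rewrite /r; lra.
  have := FP' _ _ yr' zr'; have := is_norm_triangle NP y (- z).
  by rewrite (is_normN NP) ler_norml /D; move: yr' zr'; lra.
have GF x : N x <= r -> mdist (G x) (F x) <= P * ((W + e1) * m%:R).
  apply: Ab => u uvs y yr i im; apply: le_trans (steps _ _ _ yr uvs (ltnW im)) _.
  by have := vsm u uvs; rewrite /wm; lra.
have Glow x y : N x <= r -> N y <= r ->
    N (x - y) - (e1 + 2 * (P * (W + e1))) * m%:R <= mdist (G x) (G y).
  move=> xr yr; have := GF x xr; have := GF y yr.
  have xr' : N x <= (2 * P + 3) * wk by apply: le_trans xr _; rewrite /r; lra.
  have yr' : N y <= (2 * P + 3) * wk by apply: le_trans yr _; rewrite /r; lra.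
  have := FP' _ _ xr' yr'.
  have := metric_triangle (F x) (G x) (F y).
  have := metric_triangle (G x) (G y) (F y).
  by rewrite (metric_sym (F x) (G x)) ler_norml; lra.
(* The deficit in the upper bound [Gup]; making all deficits small at one [x0] gives the lower
   bounds. *)
pose f (j : 'rV[R]_n * 'rV[R]_n) x :=
  N (v j) + 2 * e1 - mdist (G (x + j.1)) (G (x + j.2)).
have vjE j x : x + j.2 = x + j.1 + v j by rewrite /v addrA addrAC addrK.
pose c := 2 * e1 + (e1 + 2 * (P * (W + e1))) / Q%:R.
have [j jJ|j jJ x xP|x0 x0r x0P] := @simultaneous_average R 'rV[R]_n N NP k wk k0
  _ J v f c wk0.
- by rewrite ler_wpM2l ?NJ // ltW.
- have [uU u'U] := JU j jJ; have vvs : v j \in vs by apply: map_f.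
  rewrite -/P in xP.
  have xr1 : N (x + j.1) <= P * wk + wk.
    apply: le_trans (is_norm_triangle NP _ _) _; have := NU _ uU.
    have := is_norm_ge0 NP j.1; move: xP Wwk; lra.
  split.
    by rewrite /f subr_ge0 vjE; apply: Gup => //; rewrite /r; lra.
  rewrite /line_average ler_pdivrMl //.
  (* By [Glow] this path has length at least [k%:R * N (v j)] up to an error linear in [m]; division
     by [k = Q * m] gives [c]. *)
  have path := mdist_path (fun i => G (x + j.1 + i%:R *: v j)) k.
  have -> : \sum_(i < k) f j (x + i%:R *: v j) = k%:R * (N (v j) + 2 * e1) -
      \sum_(i < k) mdist (G (x + j.1 + i%:R *: v j)) (G (x + j.1 + i.+1%:R *: v j)).
    rewrite sumrB sumr_const card_ord; congr (_ - _); first by rewrite (mulr_natl _ k).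
    apply: eq_bigr => i _; congr (mdist (G _) (G _)); first by rewrite addrAC.
    by rewrite vjE (addrAC x) -[i.+1%:R]natr1 scalerDl scale1r (addrA (x + j.1)).
  have kv : k%:R * N (v j) <= wk by rewrite ler_wpM2l ?NJ // ltW.
  have xr2 : N (x + j.1 + k%:R *: v j) <= r.
    apply: le_trans (is_norm_triangle NP _ _) _; rewrite (is_norm_natmul NP) /r.
    by move: xr1 kv; lra.
  have xr3 : N (x + j.1) <= r by rewrite /r; lra.
  have := Glow _ _ xr3 xr2; rewrite opprD addNKr (is_normN NP) (is_norm_natmul NP).
  have -> : k%:R * c = k%:R * (2 * e1) + (e1 + 2 * (P * (W + e1))) * m%:R.
    by rewrite /c kE; field; rewrite gt_eqF // (lt_le_trans ltr01).
  move: path; rewrite /= scale0r addr0; lra.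
have Pc : P * c <= e.
  have QR : 0 < Q%:R :> R by rewrite (lt_le_trans ltr01).
  have -> : P * c = 2 * (P * e1) + P * (e1 + 2 * (P * (W + e1))) / Q%:R.
    by rewrite /c; ring.
  have : P * (e1 + 2 * (P * (W + e1))) / Q%:R <= e / 2.
    rewrite ler_pdivrMr //.
    have : P * (e1 + 2 * (P * (W + e1))) <= P * (1 + 2 * (P * (W + 1))).
      rewrite ler_wpM2l //; apply: lerD => //.
      by rewrite ler_pM2l // ler_wpM2l // lerD2l.
    by move: QP; lra.
  by move: e1P e10; lra.
exists (fun u => G (x0 + u)) => u u' uU u'U.
have jJ : (u, u') \in J by apply: allpairs_f.
have := x0P _ jJ; rewrite -/P /f /= => low.
have x0u : N (x0 + u) <= r.
  apply: le_trans (is_norm_triangle NP _ _) _; have := NU _ uU.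
  have := is_norm_ge0 NP u; move: x0r Wwk; rewrite -/P /r; lra.
have up : mdist (G (x0 + u)) (G (x0 + u')) <= N (v (u, u')) + 2 * e1.
  by rewrite (vjE (u, u')); apply: Gup => //; exact: map_f.
have vE : N (v (u, u')) = N (u - u') by rewrite /v /= is_normB.
have Pe1 : 0 <= P * e1 by rewrite mulr_ge0 // ltW.
by move: low up; rewrite vE ler_norml; lra.
Qed.

End FiniteRealization.

(** * Passing to an exact isometric embedding *)

Section IsometricRealization.
Context {R : realType} (X : metricType R).
Hypotheses (X_proper : proper_space X) (X_cocompact : cocompact_isometry_group X).

Lemma metric_cvg_dist (I : Type) (U : set_system I) (UF : ProperFilter U)
    (f g : I -> X) (p q : X) (h : I -> R) (l : R) :
  f @ U --> p -> g @ U --> q -> h @ U --> l ->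
  (forall e, 0 < e -> \forall i \near U, `|mdist (f i) (g i) - h i| <= e) ->
  mdist p q = l.
Proof.
move=> fp gq hl fgh; apply/eqP; rewrite -subr_eq0 -normr_le0.
apply/ler_addgt0Pr => e e0; rewrite add0r; have e4 : 0 < e / 4 by rewrite divr_gt0.
have /metricType_numDomainType.cvgrPdist_lt/(_ _ e4) h1 := fp.
have /metricType_numDomainType.cvgrPdist_lt/(_ _ e4) h2 := gq.
have /cvgrPdist_le/(_ _ e4) h3 := hl.
have [i [[i1 i2] [i3 i4]]] := filter_ex (filterI (filterI h1 h2) (filterI h3 (fgh _ e4))).
have := metric_triangle p (f i) q; have := metric_triangle (f i) (g i) q.
have := metric_triangle (f i) p (g i); have := metric_triangle p q (g i).
move: i1 i2 i3 i4; rewrite (metric_sym (g i)) (metric_sym (f i) p) !ler_norml; lra.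
Qed.

(** Isometries bring the images of 0 into the compact set [K]; then the images of each [x] stay in a
    compact ball, and pointwise ultralimits over finite subsets of [V] give the embedding. *)
Lemma realize_isometrically (V : lmodType R) (N : V -> R) :
  (forall (s : seq V) (e : R), 0 < e -> exists phi : V -> X,
    forall u u', u \in s -> u' \in s -> `|mdist (phi u) (phi u') - N (u - u')| <= e) ->
  exists f : V -> X, forall x y, mdist (f x) (f y) = N (x - y).
Proof.
move=> NX; have [K [Kc KX]] := X_cocompact.
have [U [UU Ux Um]] := @finite_subsets_ultrafilter V.
have h0 (i : seq V * nat) : 0 < i.2.+1%:R^-1 :> R by rewrite invr_gt0 ltr0n.
have phiK (i : seq V * nat) : exists phi : V -> X, K (phi 0) /\
    forall u u', u \in i.1 -> u' \in i.1 ->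
      `|mdist (phi u) (phi u') - N (u - u')| <= i.2.+1%:R^-1.
  have [phi phiP] := NX i.1 _ (h0 i).
  have : [set: X] (phi 0) by [].
  rewrite -KX => -[g /= [[h gK hK] giso] [z Kz gz]].
  exists (h \o phi); split => [|u u' us u's]; first by rewrite /= -gz gK.
  by rewrite /= -giso !hK phiP.
have {phiK} [phi phiP] := choice phiK.
have [p phip] : exists p : X, phi i 0 @[i --> U] --> p.
  by apply: (ultra_cvg_compact UU Kc); apply: (@filterE _ U) => i; have [] := phiP i.
have phix x : exists q : X, phi i x @[i --> U] --> q.
  (* Of the added 2, one unit covers the distance from [p] to [phi i 0], the other the realization
     error. *)
  apply: (@ultra_cvg_compact _ X U (phi^~ x) _ UU (@X_proper p (N (0 - x) + 2))).
  have /metricType_numDomainType.cvgrPdist_lt/(_ _ ltr01) h1 := phip.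
  apply: filterS3 h1 (Ux x) (Ux 0) => i i1 ix i0 /=.
  have [_ /(_ _ _ i0 ix)] := phiP i; have := metric_triangle p (phi i 0) (phi i x).
  have : i.2.+1%:R^-1 <= 1 :> R by rewrite invf_le1 ?ler1n ?ltr0n.
  by move: (i.2.+1%:R^-1) i1 => H i1; rewrite ler_norml; lra.
have [f fP] := choice phix; exists f => x y.
apply: (metric_cvg_dist _ (fP x) (fP y) (cvg_cst (N (x - y)))) => e e0.
apply: filterS3 (Ux x) (Ux y) (ultra_nat_infty UU Um e0) => i ix iy ie.
by have [_ /(_ _ _ ix iy)] := phiP i; move/le_trans; apply.
Qed.

End IsometricRealization.

(** * Maps into asymptotic cones *)

Section Cones.
Context {R : realType} (X : metricType R).

Lemma nonprincipal_ultrafilter : exists U : set_system nat,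
  [/\ UltraFilter U, \oo `<=` U & forall k, U <> principal_filter k].
Proof.
have [U [UU ooU]] := @ultraFilterLemma nat \oo _.
exists U; split => // k Uk.
have : U [set j | (k < j)%N] by apply: ooU; exists k.+1.
by rewrite Uk => /(_ k erefl) /=; rewrite ltnn.
Qed.

(** The cone has constant base point [f 0], and [g x] is the class of the sequence
    [f (k.+1%:R *: x)]. The inclusion of [\oo] lets estimates for large [k] be used in the limit. *)
Lemma cone_of_map (V : lmodType R) (f : V -> X) :
  (forall x, exists M : R, forall k : nat,
    k.+1%:R^-1 * mdist (f (k.+1%:R *: x)) (f 0) <= M) ->
  exists (c : cone_data X) (g : V -> asymptotic_cone c), \oo `<=` cone_filter c /\
    forall x y, k.+1%:R^-1 * mdist (f (k.+1%:R *: x)) (f (k.+1%:R *: y))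
      @[k --> cone_filter c] --> (mdist (g x) (g y) : R).
Proof.
move=> fM; have [U [UU ooU Unp]] := nonprincipal_ultrafilter.
have l0 (k : nat) : 0 < k.+1%:R :> R by rewrite ltr0n.
have loo : (k.+1%:R : R) @[k --> U] --> +oo.
  apply: cvg_trans (_ : k.+1%:R @[k --> \oo] --> +oo).
    by move=> A; exact: ooU.
  by rewrite (cvg_shiftS (fun k => k%:R : R)); exact: cvgr_idn.
pose c := @ConeData R X U UU Unp (fun=> f 0) (fun k => k.+1%:R) l0 loo.
have bnd x : `[< cone_bounded c (fun k => f (k.+1%:R *: x)) >] by apply/asboolP/fM.
pose s x : cone_seq c := exist (fun z => `[< cone_bounded c z >]) _ (bnd x).
exists c, (fun x => \pi_(asymptotic_cone c)%qT (s x)); split => // x y.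
by rewrite mdist_coneE; exact: (@cone_seq_dist_cvg R X c (s x) (s y)).
Qed.

(** Representatives of finitely many cone points, evaluated at one suitable [k], realize their
    distances at scale [cone_scale c k]. *)
Lemma cone_coarsely_realized (V : normedModType R) (c : cone_data X)
    (g : V -> asymptotic_cone c) :
  coarsely_realized X (fun x y => mdist (g x) (g y)).
Proof.
move=> s e T e0; have UU := cone_ultra c.
pose psi k x := val (repr (g x)) k.
pose P k := forall u, u \in allpairs pair s s ->
  `|mdist (g u.1) (g u.2) - (cone_scale c k)^-1 * mdist (psi k u.1) (psi k u.2)| <= e.
have nearP : \forall k \near cone_filter c, P k.
  rewrite /P; elim: (allpairs _ _ _) => [|u l IH]; first exact: filterE.
  have := @cone_seq_dist_cvg R X c (repr (g u.1)) (repr (g u.2)).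
  move=> /cvgrPdist_le/(_ _ e0).
  apply: filterS2 IH => k IH uk z; rewrite inE => /predU1P[-> //|]; exact: IH.
have /cvgryPge/(_ T) nearT := @cone_scale_infty R X c.
have [k [Pk Tk]] := filter_ex (filterI nearP nearT).
have l0 := cone_scale_gt0 c k.
exists (cone_scale c k), (psi k); split => // x y xs ys.
have -> : mdist (psi k x) (psi k y) - cone_scale c k * mdist (g x) (g y) =
    ((cone_scale c k)^-1 * mdist (psi k x) (psi k y) - mdist (g x) (g y)) * cone_scale c k.
  by field; rewrite gt_eqF.
rewrite normrM (gtr0_norm l0) ler_pM2r // distrC.
exact: (Pk (x, y) (allpairs_f pair xs ys)).
Qed.

End Cones.

(** * Row vectors normed or metrized by [N] *)

Section NormedRow.
Context {R : realType} (n : nat) (N : 'rV[R]_n -> R) (NP : is_norm N).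

(** The proof argument is a phantom on which the instances depend; the alias keeps [N] apart from
    the sup norm. *)
Definition normed_row of is_norm N : Type := 'rV[R]_n.

HB.instance Definition _ := GRing.Lmodule.copy (normed_row NP) 'rV[R]_n.
HB.instance Definition _ := Lmodule_isNormed.Build R (normed_row NP)
  (is_norm_triangle NP) (is_norm_homogeneous NP) (is_norm_definite NP).

Lemma normed_row_vector_axiom : Vector.axiom n (normed_row NP).
Proof. by exists id => //; exists id. Qed.

(** Serves as the common ambient space in a Gromov-Hausdorff comparison. *)
Definition metric_row of is_norm N : Type := 'rV[R]_n.

HB.instance Definition _ := Choice.copy (metric_row NP) 'rV[R]_n.

Let dist (x y : metric_row NP) : R := N ((x : 'rV[R]_n) - y).

Let distxx x : dist x x = 0.
Proof. by rewrite /dist subrr is_norm0. Qed.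

Let dist_positivity x y : dist x y = 0 -> x = y.
Proof. by move=> /(is_norm_definite NP)/eqP; rewrite subr_eq0 => /eqP. Qed.

Let dist_sym x y : dist x y = dist y x.
Proof. by rewrite /dist is_normB. Qed.

Let dist_triangle y x z : dist x z <= dist x y + dist y z.
Proof. exact: is_norm_dist. Qed.

HB.instance Definition _ := isMetric.Build R (metric_row NP)
  distxx dist_positivity dist_sym dist_triangle.

Lemma metric_row_mdistE (x y : metric_row NP) : mdist x y = N ((x : 'rV[R]_n) - y).
Proof. by []. Qed.

End NormedRow.

(** * Gromov-Hausdorff approximations of unit balls *)

Section GromovHausdorff.
Context {R : realType}.

Lemma hausdorff_dist_ge0 (Z : metricType R) (A B : set Z) : (0 <= hausdorff_dist A B)%E.
Proof. by apply/ereal_infP => _ [e [e0 _ _] <-]; rewrite lee_fin ltW. Qed.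

Lemma hausdorff_distxx (Z : metricType R) (A : set Z) : hausdorff_dist A A = 0%E.
Proof.
apply/eqP; rewrite eq_le hausdorff_dist_ge0 andbT; apply/lee_addgt0Pr => e e0.
rewrite add0e; apply: ereal_inf_lbound; exists e => //; split => //.
  by move=> x Ax; exists x => //; exact: ballxx.
by move=> x Ax; exists x => //; exact: ballxx.
Qed.

Lemma gromov_hausdorff_dist_ge0 (S T : Type) (dA : S -> S -> R) (A : set S)
    (dB : T -> T -> R) (B : set T) : (0 <= gromov_hausdorff_dist dA A dB B)%E.
Proof. by apply/ereal_infP => _ [Z [f [g [_ _ ->]]]]; exact: hausdorff_dist_ge0. Qed.

(** [phi] matches each point of [B] with one of [A] closer than [e] in the common space; each
    endpoint contributes one [e]. *)
Lemma gromov_hausdorff_approx (S T : Type) (dA : S -> S -> R) (A : set S)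
    (dB : T -> T -> R) (B : set T) (e : R) : B !=set0 ->
  (gromov_hausdorff_dist dA A dB B < e%:E)%E ->
  exists phi : T -> S, forall x y, B x -> B y ->
    `|dA (phi x) (phi y) - dB x y| <= 2 * e.
Proof.
move=> [b0 Bb0] /ereal_inf_lt[h [Z [f [g [fA gB ->]]]]] /ereal_inf_lt[_ [d [d0 _ BA] <-]].
rewrite lte_fin => de.
have [_ [s0 _ _] _] := BA (g b0) (ex_intro2 _ _ b0 Bb0 erefl).
have phiP x : exists s, B x -> A s /\ mdist (f s) (g x) < d.
  have [Bx|nBx] := pselect (B x); last by exists s0.
  have [_ [s As <-]] := BA (g x) (ex_intro2 _ _ x Bx erefl).
  by rewrite ballEmdist /= => sx; exists s.
have [phi phiB] := choice phiP; exists phi => x y Bx By.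
have [Ax dx] := phiB x Bx; have [Ay dy] := phiB y By.
rewrite -fA // -gB //.
have := metric_triangle (f (phi x)) (g x) (f (phi y)).
have := metric_triangle (g x) (g y) (f (phi y)).
have := metric_triangle (g x) (f (phi x)) (g y).
have := metric_triangle (f (phi x)) (f (phi y)) (g y).
rewrite (metric_sym (g y) (f _)) (metric_sym (g x) (f _)) ler_norml.
by move: dx dy de; lra.
Qed.

Context (n : nat) (N : 'rV[R]_n -> R) (NP : is_norm N).

Lemma rescaled_cvg_approx (Y : metricType R) (r : nat -> R) (S : nat -> set Y) (e : R) :
  rescaled_cvg_unit_ball r S N -> 0 < e ->
  \forall k \near \oo, exists phi : 'rV[R]_n -> Y, forall x y, N x <= 1 -> N y <= 1 ->
    `|(r k)^-1 * mdist (phi x) (phi y) - N (x - y)| <= e.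
Proof.
move=> rS e0; have e2 : 0 < e / 2 by rewrite divr_gt0.
have B0 : [set x | N x <= 1] !=set0 by exists 0; rewrite /= (is_norm0 NP).
have : \forall k \near \oo, (gromov_hausdorff_dist (fun x y => (r k)^-1 * mdist x y)%R (S k)
    (fun x y => N (x - y)%R) [set x | (N x <= 1)%R] < (e / 2)%:E)%E.
  have := rS; rewrite /rescaled_cvg_unit_ball => /(_ [set z | (z < (e / 2)%:E)%E]).
  apply; apply: open_nbhs_nbhs; split; last by rewrite /= lte_fin.
  exact: open_ereal_lt_ereal.
apply: filterS => k /(gromov_hausdorff_approx B0)[phi phiP]; exists phi => x y x1 y1.
by have := phiP x y x1 y1; rewrite (mulrC 2) divfK.
Qed.

Lemma rescaled_cvg_images (Y : metricType R) (r : nat -> R)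
    (phi : nat -> 'rV[R]_n -> Y) : (forall k, 0 < r k) ->
  (forall k x y, mdist (phi k x) (phi k y) = r k * N (x - y)) ->
  rescaled_cvg_unit_ball r (fun k => phi k @` [set x | N x <= 1]) N.
Proof.
move=> r0 phiP; rewrite /rescaled_cvg_unit_ball.
have -> : (fun k => gromov_hausdorff_dist (fun x y => (r k)^-1 * mdist x y)
    (phi k @` [set x | N x <= 1]) (fun x y => N (x - y)) [set x | N x <= 1]) = fun=> 0%E.
  apply/funext => k; apply/eqP; rewrite eq_le gromov_hausdorff_dist_ge0 andbT.
  have rk : r k != 0 by rewrite gt_eqF.
  have inj x y : phi k x = phi k y -> x = y.
    move=> xy; have := phiP k x y; rewrite xy mdistxx => /esym/eqP.
    by rewrite mulf_eq0 (negbTE rk) => /eqP/(is_norm_definite NP)/eqP; rewrite subr_eq0 => /eqP.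
  (* The inverse of [phi k], with value 0 off its image, embeds the rescaled set onto the unit ball
     of [metric_row NP]. *)
  have invP z : exists x, (exists x', phi k x' = z) -> phi k x = z.
    by have [[x xz]|nz] := pselect (exists x', phi k x' = z); [exists x|exists 0].
  have [inv invphi] := choice invP.
  have invK x : inv (phi k x) = x by apply: inj; apply: invphi; exists x.
  rewrite -(hausdorff_distxx [set x : metric_row NP | N x <= 1]).
  apply: ereal_inf_lbound; exists (metric_row NP), inv, id; split.
  - move=> _ _ [x _ <-] [y _ <-]; rewrite !invK metric_row_mdistE phiP.
    by rewrite mulKf.
  - by [].
  - congr hausdorff_dist; last by rewrite image_id.
    apply/seteqP; split => [x x1|_ [_ [x x1 <-] <-]]; last by rewrite invK.
    by exists (phi k x) => //; exists x.
exact: cvg_cst.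
Qed.

End GromovHausdorff.

(** * Comparison of the Euclidean norm with the sup norm *)

Section EuclideanNorm.
Context {R : realType} (n : nat).
Implicit Types x : 'rV[R]_n.

Lemma euclidean_norm_ge x : `|x| <= euclidean_norm x.
Proof.
apply: rV_norm_le => [|i]; first exact: sqrtr_ge0.
rewrite /euclidean_norm -sqrtr_sqr ler_wsqrtr // (bigD1 i) //= lerDl.
by apply: sumr_ge0 => j _; rewrite sqr_ge0.
Qed.

Lemma euclidean_norm_le x : euclidean_norm x <= n%:R * `|x|.
Proof.
rewrite /euclidean_norm -[leRHS]ger0_norm ?mulr_ge0 // -sqrtr_sqr ler_wsqrtr //.
apply: (@le_trans _ _ (n%:R * `|x| ^+ 2)).
  rewrite -[X in X%:R](card_ord n) mulr_natl -sumr_const; apply: ler_sum => i _.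
  by rewrite -[leLHS]ger0_norm ?sqr_ge0 // normrX lerXn2r ?nnegrE // rV_coord_le.
rewrite exprMn ler_wpM2r ?sqr_ge0 // -natrX ler_nat.
by case: (n) => // k; rewrite leq_pmulr.
Qed.

Lemma euclidean_normZ (a : R) (x : 'rV[R]_n) :
  euclidean_norm (a *: x) = `|a| * euclidean_norm x.
Proof.
rewrite /euclidean_norm -sqrtr_sqr -sqrtrM ?sqr_ge0 // mulr_sumr; congr Num.sqrt.
by apply: eq_bigr => i _; rewrite mxE exprMn.
Qed.

End EuclideanNorm.

(** * The individual implications *)

Section Implications.
Context {R : realType} (X : metricType R) (n : nat).

Lemma isometric_embedding_norm :
  (exists V : normedModType R, inhabited (Vector.axiom n V) /\
    exists f : V -> X, isometric_embedding f) ->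
  exists (N : 'rV[R]_n -> R) (f : 'rV[R]_n -> X),
    is_norm N /\ forall x y, mdist (f x) (f y) = N (x - y).
Proof.
move=> [V [[[v2r v2rL [r2v v2rK r2vK]]] [f fP]]].
have r2vD a x y : r2v (a *: x + y) = a *: r2v x + r2v y.
  by apply: (can_inj v2rK); rewrite r2vK v2rL !r2vK.
have r2v0 : r2v 0 = 0.
  by apply: (addrI (1 *: r2v 0)); rewrite -r2vD !scale1r !addr0.
have r2vB x y : r2v (x - y) = r2v x - r2v y.
  by have := r2vD (-1) y x; rewrite !scaleN1r !(addrC (- _)).
exists (fun x => `|r2v x|), (f \o r2v); split => [|x y]; last by rewrite /= fP r2vB.
split => [x y|a x|x /eqP].
- by have := r2vD 1 x y; rewrite !scale1r => ->; exact: ler_normD.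
- by rewrite -[a *: x]addr0 r2vD r2v0 addr0 normrZ.
- by rewrite normr_eq0 => /eqP rx; rewrite -[x]r2vK rx -r2v0 r2vK.
Qed.

Lemma norm_embedding_quasi_isometric (N : 'rV[R]_n -> R) (f : 'rV[R]_n -> X) :
  is_norm N -> (forall x y, mdist (f x) (f y) = N (x - y)) ->
  quasi_isometric_embedding f.
Proof.
move=> NP fP; have [C C0 NC] := is_norm_le_norm NP; have [C' C'0 NC'] := norm_le_is_norm NP.
(* The summands serve, in order, for [1 <= L], the upper bound and the lower bound. *)
exists (1 + C + n%:R * C'), 0; have nC : 0 <= n%:R * C' by rewrite mulr_ge0 // ltW.
split => // [|x y]; first by rewrite -addrA lerDl addr_ge0 // ltW.
have L0 : 0 < 1 + C + n%:R * C' by rewrite ltr_pwDl // ltr_pwDl // ltW.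
rewrite subr0 addr0 fP ler_pdivrMl //.
have N0 := is_norm_ge0 NP (x - y).
have E0 : 0 <= euclidean_norm (x - y) by exact: sqrtr_ge0.
apply/andP; split.
  apply: le_trans (euclidean_norm_le _) _.
  have : n%:R * `|x - y| <= n%:R * (C' * N (x - y)) by rewrite ler_wpM2l.
  have : 0 <= C * N (x - y) by rewrite mulr_ge0 // ltW.
  by move: N0; lra.
apply: le_trans (NC _) _; have : C * `|x - y| <= C * euclidean_norm (x - y).
  by rewrite ler_pM2l // euclidean_norm_ge.
have : 0 <= n%:R * C' * euclidean_norm (x - y) by rewrite mulr_ge0.
by move: E0; lra.
Qed.

(** Rescaling by [k.+1%:R^-1] divides the additive constant by [k.+1%:R] and keeps [L], so only [L]
    survives in the cone. *)
Lemma quasi_isometric_cone (f : 'rV[R]_n -> X) : quasi_isometric_embedding f ->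
  exists (c : cone_data X) (g : 'rV[R]_n -> asymptotic_cone c), bilipschitz_embedding g.
Proof.
move=> [L [C [L1 C0 fP]]].
have bounds (k : nat) x y : L^-1 * euclidean_norm (x - y) - C / k.+1%:R <=
    k.+1%:R^-1 * mdist (f (k.+1%:R *: x)) (f (k.+1%:R *: y)) <=
    L * euclidean_norm (x - y) + C / k.+1%:R.
  have k0 : 0 < k.+1%:R :> R by rewrite ltr0n.
  rewrite ler_pdivlMl // ler_pdivrMl //.
  have := fP (k.+1%:R *: x) (k.+1%:R *: y); rewrite -scalerBr euclidean_normZ.
  rewrite (gtr0_norm k0) mulrBr mulrDr !(mulrCA k.+1%:R) mulfV ?gt_eqF //.
  by rewrite mulr1 !mulrA.
have [|c [g [ooc gP]]] := @cone_of_map R X _ f.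
  move=> x; exists (L * euclidean_norm x + C) => k.
  have /andP[_] := bounds k x 0; rewrite scaler0 subr0 => /le_trans; apply.
  by rewrite lerD2l ler_pdivrMr ?ltr0n // ler_peMr // ler1n.
exists c, g, L; split => // x y.
have UU := cone_ultra c.
have nearC e : 0 < e -> \forall k \near cone_filter c, C / k.+1%:R <= e.
  move=> e0; apply: ooc.
  have e1 : 0 < e / (C + 1) by rewrite divr_gt0 // ltr_wpDl.
  apply: filterS (near_infty_natSinv_lt (PosNum e1)) => k /= ke.
  rewrite mulrC; apply: le_trans (ler_wpM2r C0 (ltW ke)) _.
  by rewrite mulrAC ler_pdivrMr ?ltr_wpDl // ler_pM2l // lerDl.
apply/andP; split; apply/ler_addgt0Pr => e e0.
  rewrite -lerBlDr; apply: (cvgr_to_ge (gP x y)).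
  apply: filterS (nearC e e0) => k ke; have /andP[+ _] := bounds k x y.
  by apply: le_trans; rewrite lerD2l lerN2.
apply: (cvgr_to_le (gP x y)).
apply: filterS (nearC e e0) => k ke; have /andP[_] := bounds k x y.
by move/le_trans; apply; rewrite lerD2l.
Qed.

Lemma bilipschitz_cone_norm (c : cone_data X) (g : 'rV[R]_n -> asymptotic_cone c) :
  bilipschitz_embedding g -> exists N : 'rV[R]_n -> R,
    is_norm N /\ coarsely_realized X (fun x y => N (x - y)).
Proof.
move=> [L [L1 gP]]; have L0 : 0 < L by rewrite (lt_le_trans ltr01).
apply: (@coarse_metric_differentiation R _ X L^-1 (L * n%:R) _
  (cone_coarsely_realized g)).
- move=> x y; have /andP[lo up] := gP x y; apply/andP; split.
    by apply: le_trans lo; rewrite ler_pM2l ?invr_gt0 // euclidean_norm_ge.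
  by apply: le_trans up _; rewrite -mulrA ler_pM2l // euclidean_norm_le.
- by rewrite invr_gt0.
- by rewrite mulr_ge0 // ltW.
Qed.

Lemma norm_bounded_on (N : 'rV[R]_n -> R) (s : seq 'rV[R]_n) : is_norm N ->
  exists2 b : R, 0 < b & forall x, x \in s -> N (b^-1 *: x) <= 1.
Proof.
move=> NP; have S0 : 0 <= \sum_(x <- s) N x.
  by apply: sumr_ge0 => x _; exact: is_norm_ge0.
exists (\sum_(x <- s) N x + 1); first by rewrite ltr_wpDl.
move=> x xs; have b0 : 0 < \sum_(x <- s) N x + 1 by rewrite ltr_wpDl.
rewrite (is_norm_homogeneous NP) gtr0_norm ?invr_gt0 // ler_pdivrMl // mulr1.
rewrite (perm_big _ (perm_to_rem xs)) big_cons /= -addrA lerDl addr_ge0 //.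
by apply: sumr_ge0 => y _; exact: is_norm_ge0.
Qed.

(* With [b] chosen so that [b^-1 *: s] lies in the unit ball, a Gromov-Hausdorff
   approximation of the ball at scale [r k] realizes [N] on [s] at scale [r k / b]. *)
Lemma rescaled_cvg_on_finite (N : 'rV[R]_n -> R) (Y : metricType R) (r : nat -> R)
    (S : nat -> set Y) (s : seq 'rV[R]_n) (e : R) : is_norm N ->
  (forall k, 0 < r k) -> rescaled_cvg_unit_ball r S N -> 0 < e ->
  exists2 b : R, 0 < b & \forall k \near \oo, exists phi : 'rV[R]_n -> Y,
    forall x y, x \in s -> y \in s ->
      `|mdist (phi x) (phi y) - r k / b * N (x - y)| <= e * (r k / b).
Proof.
move=> NP r0 rS e0; have [b b0 bP] := norm_bounded_on s NP; exists b => //.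
have eb : 0 < e / b by rewrite divr_gt0.
apply: filterS (rescaled_cvg_approx NP rS eb) => k [phi phiP].
exists (fun x => phi (b^-1 *: x)) => x y xs ys.
have := phiP _ _ (bP x xs) (bP y ys).
rewrite -scalerBr (is_norm_homogeneous NP) (gtr0_norm (_ : 0 < b^-1)) ?invr_gt0 //.
rewrite -(ler_pM2r (r0 k)) -{2}(gtr0_norm (r0 k)) -normrM => /le_trans/(_ _).
set a := mdist _ _.
have -> : ((r k)^-1 * a - b^-1 * N (x - y)) * r k = a - r k / b * N (x - y).
  by field; rewrite !gt_eqF.
by move=> h; apply: h; rewrite mulrAC mulrA.
Qed.

Lemma rescaled_cvg_coarse (N : 'rV[R]_n -> R) (r : nat -> R) (S : nat -> set X) :
  is_norm N -> (forall k, 0 < r k) -> r k @[k --> \oo] --> +oo ->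
  rescaled_cvg_unit_ball r S N -> coarsely_realized X (fun x y => N (x - y)).
Proof.
move=> NP r0 roo rS s e T e0.
have [b b0 bP] := rescaled_cvg_on_finite s NP r0 rS e0.
have /cvgryPge/(_ (T * b)) roo' := roo.
have [k [[phi phiP] Tk]] := filter_ex (filterI bP roo').
by exists (r k / b), phi; rewrite ler_pdivlMr // divr_gt0.
Qed.

(** An approximation into the cone at scale [r k / b] is followed by a realization of the cone in
    [X] at scale [l]; however small [r k] is, the product becomes large through [l]. *)
Lemma rescaled_cvg_cone_coarse (N : 'rV[R]_n -> R) (c : cone_data X) (r : nat -> R)
    (Z : nat -> set (asymptotic_cone c)) :
  is_norm N -> (forall k, 0 < r k) ->
  rescaled_cvg_unit_ball r Z N -> coarsely_realized X (fun x y => N (x - y)).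
Proof.
move=> NP r0 rZ s e T e0; have e2 : 0 < e / 2 by rewrite divr_gt0.
have [b b0 bP] := rescaled_cvg_on_finite s NP r0 rZ e2.
have [k [phi phiP]] := filter_ex bP.
have rb : 0 < r k / b by rewrite divr_gt0.
have erb : 0 < e / 2 * (r k / b) by rewrite mulr_gt0.
have [l [psi [Tl l0 psiP]]] := cone_coarsely_realized phi s (T / (r k / b)) erb.
exists (l * (r k / b)), psi; split => [| |x y xs ys].
- by rewrite -ler_pdivrMr.
- by rewrite mulr_gt0.
- have := psiP x y xs ys; have := phiP x y xs ys.
  rewrite -(ler_pM2l l0) -{1}(gtr0_norm l0) -normrM !ler_norml; lra.
Qed.

Lemma norm_embedding_rescaled_cvg (N : 'rV[R]_n -> R) (f : 'rV[R]_n -> X) :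
  is_norm N -> (forall x y, mdist (f x) (f y) = N (x - y)) ->
  exists (S : nat -> set X) (r : nat -> R),
    [/\ forall k, 0 < r k, r k @[k --> \oo] --> +oo & rescaled_cvg_unit_ball r S N].
Proof.
move=> NP fP; have r0 (k : nat) : 0 < k.+1%:R :> R by rewrite ltr0n.
exists (fun k => (fun x => f (k.+1%:R *: x)) @` [set x | N x <= 1]), (fun k => k.+1%:R).
split => //.
  by rewrite (cvg_shiftS (fun k => k%:R : R)); exact: cvgr_idn.
by apply: (rescaled_cvg_images NP r0) => k x y; rewrite fP -scalerBr is_norm_natmul.
Qed.

(** Blowing down [f] gives an embedding of the same norm into a cone; the sets are the images of its
    balls of radius [k.+1%:R^-1]. *)
Lemma norm_embedding_cone_rescaled_cvg (N : 'rV[R]_n -> R) (f : 'rV[R]_n -> X) :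
  is_norm N -> (forall x y, mdist (f x) (f y) = N (x - y)) ->
  exists (c : cone_data X) (Z : nat -> set (asymptotic_cone c)) (r : nat -> R),
    [/\ forall k, 0 < r k, r k @[k --> \oo] --> 0 & rescaled_cvg_unit_ball r Z N].
Proof.
move=> NP fP.
have scale (k : nat) x y :
    k.+1%:R^-1 * mdist (f (k.+1%:R *: x)) (f (k.+1%:R *: y)) = N (x - y).
  by rewrite fP -scalerBr is_norm_natmul // mulKf // gt_eqF // ltr0n.
have [|c [g [_ gP]]] := @cone_of_map R X _ f.
  by move=> x; exists (N x) => k; have := scale k x 0; rewrite scaler0 subr0 => ->.
have UU := cone_ultra c.
have gE x y : mdist (g x) (g y) = N (x - y).
  apply/eqP; rewrite eq_le; apply/andP; split.
    by apply: (cvgr_to_le (gP x y)); apply: (@filterE _ (cone_filter c)) => k; rewrite scale.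
  by apply: (cvgr_to_ge (gP x y)); apply: (@filterE _ (cone_filter c)) => k; rewrite scale.
have r0 (k : nat) : 0 < k.+1%:R^-1 :> R by rewrite invr_gt0 ltr0n.
exists c, (fun k => (fun x => g (k.+1%:R^-1 *: x)) @` [set x | N x <= 1]),
  (fun k => k.+1%:R^-1); split => //; first exact: cvg_harmonic.
apply: (rescaled_cvg_images NP r0) => k x y.
by rewrite gE -scalerBr (is_norm_homogeneous NP) gtr0_norm.
Qed.

End Implications.

(** * From coarse norms to isometric embeddings, and the equivalence *)

Section CoarseToIsometric.
Context {R : realType} (X : metricType R) (n : nat).

Lemma coarse_norm_isometric_embedding : proper_space X ->
  (exists sigma : X -> X -> R -> X, bicombing sigma) -> cocompact_isometry_group X ->
  (exists N : 'rV[R]_n -> R, is_norm N /\ coarsely_realized X (fun x y => N (x - y))) ->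
  exists V : normedModType R, inhabited (Vector.axiom n V) /\
    exists f : V -> X, isometric_embedding f.
Proof.
move=> X_proper [sigma sigmaP] X_cocompact [N [NP Nc]].
exists (normed_row NP); split; first exact: (inhabits (normed_row_vector_axiom NP)).
exact: (realize_isometrically X_proper X_cocompact (norm_finitely_realized sigmaP NP Nc)).
Qed.

End CoarseToIsometric.

Theorem theorem3p4 (R : realType) (X : metricType R)
    (X_proper : proper_space X)
    (X_bicombing : exists sigma : X -> X -> R -> X, bicombing sigma)
    (X_cocompact : cocompact_isometry_group X)
    (n : nat) (n_gt0 : (0 < n)%N) :
  [<->
    (* (1) *)
    exists V : normedModType R, inhabited (Vector.axiom n V) /\
      exists f : V -> X, isometric_embedding f ;
    (* (2) *)
    exists f : 'rV[R]_n -> X, quasi_isometric_embedding f ;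
    (* (3) *)
    exists (c : cone_data X) (f : 'rV[R]_n -> asymptotic_cone c),
      bilipschitz_embedding f ;
    (* (4) *)
    exists (c : cone_data X) (Z : nat -> set (asymptotic_cone c))
        (r : nat -> R) (N : 'rV[R]_n -> R),
      [/\ forall k, 0 < r k, r k @[k --> \oo] --> 0, is_norm N
        & rescaled_cvg_unit_ball r Z N] ;
    (* (5) *)
    exists (S : nat -> set X) (r : nat -> R) (N : 'rV[R]_n -> R),
      [/\ forall k, 0 < r k, r k @[k --> \oo] --> +oo, is_norm N
        & rescaled_cvg_unit_ball r S N] ].
Proof.
have from_coarse := coarse_norm_isometric_embedding X_proper X_bicombing X_cocompact.
tfae.
- move=> /isometric_embedding_norm[N [f [NP fP]]]; exists f.
  exact: norm_embedding_quasi_isometric NP fP.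
- by move=> [f /quasi_isometric_cone].
(* The cone embedding is differentiated to a coarsely realized norm, hence [X] contains a normed
   space, and small balls in a cone of that space give the sets [Z]. *)
- move=> [c [g /bilipschitz_cone_norm/from_coarse]].
  move=> /isometric_embedding_norm[N [f [NP fP]]].
  have [c' [Z [r [r0 rcvg rZ]]]] := norm_embedding_cone_rescaled_cvg NP fP.
  by exists c', Z, r, N.
(* Again through an isometric embedding, whose balls of radius [k.+1%:R] give the sets [S]. *)
- move=> [c [Z [r [N [r0 _ NP rZ]]]]].
  have Nc := rescaled_cvg_cone_coarse NP r0 rZ.
  have /isometric_embedding_norm[N' [f [N'P fP]]] :=
    from_coarse n (ex_intro _ N (conj NP Nc)).
  have [S [r' [r'0 r'cvg r'S]]] := norm_embedding_rescaled_cvg N'P fP.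
  by exists S, r', N'.
- move=> [S [r [N [r0 roo NP rS]]]]; apply: from_coarse; exists N; split => //.
  exact: rescaled_cvg_coarse NP r0 roo rS.
Qed.
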